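(* Let $(\mathcal{V},\rho_1)$ and $(\mathcal{W},\theta_1)$ be chain complexes of $\mathbb{C}[\partial]$-modules together with contraction data $(p,i,h)$ from $(\mathcal{V},\rho_1)$ to $(\mathcal{W},\theta_1)$. Suppose $(\mathcal{V},\rho_1,\rho_2)$ is an $A_\infty[1]$-conformal algebra (with vanishing structure maps of arity $\ge3$). Define maps $r_k:\mathcal{V}^{\otimes k}\to\mathcal{V}[\lambda_1,\ldots,\lambda_{k-1}]$, $k\ge2$, inductively by $$r_k=\sum_{\substack{a+b=k\\ a,b\ge1}}\rho_2\big((h\circ r_a)\otimes(h\circ r_b)\big),\qquad\text{with the convention } h\circ r_1=\mathrm{id}_{\mathcal{V}},$$ and set $\theta_k:=p\circ r_k\circ i^{\otimes k}:\mathcal{W}^{\otimes k}\to\mathcal{W}[\lambda_1,\ldots,\lambda_{k-1}]$ for $k\ge2$. Then $(\mathcal{W},\{\theta_k\}_{k\ge1})$ is an $A_\infty[1]$-conformal algebra.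
   Context: All vector spaces and tensor products are over $\mathbb{C}$. A graded $\mathbb{C}[\partial]$-module is $\mathcal{V}=\oplus_{i\in\mathbb{Z}}\mathcal{V}_i$ with each $\mathcal{V}_i$ a $\mathbb{C}[\partial]$-module; $\mathcal{V}[\lambda_1,\ldots,\lambda_{k-1}]$ is graded by $\mathcal{V}_i[\lambda_1,\ldots,\lambda_{k-1}]$, with $\partial$ acting coefficientwise. A $\mathbb{C}$-linear map $\varphi:\mathcal{V}^{\otimes k}\to\mathcal{V}[\lambda_1,\ldots,\lambda_{k-1}]$ is conformal sesquilinear if $\varphi_{\lambda_1,\ldots,\lambda_{k-1}}(v_1,\ldots,\partial v_j,\ldots,v_k)=-\lambda_j\,\varphi_{\lambda_1,\ldots,\lambda_{k-1}}(v_1,\ldots,v_k)$ for $1\le j\le k-1$, and $\varphi_{\lambda_1,\ldots,\lambda_{k-1}}(v_1,\ldots,v_{k-1},\partial v_k)=(\partial+\lambda_1+\cdots+\lambda_{k-1})\varphi_{\lambda_1,\ldots,\lambda_{k-1}}(v_1,\ldots,v_k)$. All maps are extended linearly over polynomials in the $\lambda$'s. An $A_\infty[1]$-conformal algebra is a graded $\mathbb{C}[\partial]$-module $\mathcal{V}$ with degree $-1$ conformal sesquilinear maps $\rho_k:\mathcal{V}^{\otimes k}\to\mathcal{V}[\lambda_1,\ldots,\lambda_{k-1}]$, $k\ge1$, such that for all $n\ge1$ and homogeneous $v_1,\ldots,v_n$, $$\sum_{k+l=n+1}\sum_{j=1}^k(-1)^{|v_1|+\cdots+|v_{j-1}|}(\rho_k)_{\lambda_1,\ldots,\lambda_{j-1},\lambda_j+\cdots+\lambda_{j+l-1},\lambda_{j+l},\ldots,\lambda_{n-1}}\big(v_1,\ldots,v_{j-1},(\rho_l)_{\lambda_j,\ldots,\lambda_{j+l-2}}(v_j,\ldots,v_{j+l-1}),v_{j+l},\ldots,v_n\big)=0,$$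 where for $j=k$ the subscripts of $\rho_k$ are just $\lambda_1,\ldots,\lambda_{k-1}$. A chain complex of $\mathbb{C}[\partial]$-modules $(\mathcal{V},\rho_1)$ is a graded $\mathbb{C}[\partial]$-module with a $\mathbb{C}[\partial]$-linear degree $-1$ map $\rho_1$ with $\rho_1^2=0$. Contraction data from $(\mathcal{V},\rho_1)$ to $(\mathcal{W},\theta_1)$ consist of $\mathbb{C}[\partial]$-linear chain maps $p:\mathcal{V}\to\mathcal{W}$, $i:\mathcal{W}\to\mathcal{V}$ (degree $0$) and a $\mathbb{C}[\partial]$-linear degree $+1$ map $h:\mathcal{V}\to\mathcal{V}$ with $ip-\mathrm{id}_{\mathcal{V}}=\rho_1h+h\rho_1$ and $pi=\mathrm{id}_{\mathcal{W}}$. For conformal sesquilinear degree $0$ maps $\varphi,\psi$ of arities $a,b$, $\rho_2(\varphi\otimes\psi)$ is the map of arity $a+b$ given by $$(v_1,\ldots,v_{a+b})\mapsto(\rho_2)_{\lambda_1+\cdots+\lambda_a}\big(\varphi_{\lambda_1,\ldots,\lambda_{a-1}}(v_1,\ldots,v_a),\psi_{\lambda_{a+1},\ldots,\lambda_{a+b-1}}(v_{a+1},\ldots,v_{a+b})\big).$$ *)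

(* Defs.v *)
From HB Require Import structures.
From mathcomp Require Import all_boot all_order all_algebra.
From mathcomp Require Import finmap xfinmap monalg.

Set Implicit Arguments.
Unset Strict Implicit.
Unset Printing Implicit Defensive.

Import GRing.Theory BigEnoughFSet.
Local Open Scope ring_scope.

(* A C[d]-module is an [lmodType {poly C}], with d acting as ['X *: _].       *)

(* V[lambda_1, ..., lambda_n]: finitely supported families of elements of V   *)
(* indexed by the monomials in n variables; [u@_m] is the coefficient of m.   *)
Definition lpoly (A : comNzRingType) (V : lmodType A) (n : nat) : Type :=
  {malg V['X_{1..n}]}.

HB.instance Definition _ (A : comNzRingType) (V : lmodType A) (n : nat) :=
  GRing.Zmodule.copy (lpoly V n) {malg V['X_{1..n}]}.

(* V[lambda_1, ..., lambda_n] is a module over A[lambda_1, ..., lambda_n],    *)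
(* here with A = C[d]; in particular d acts coefficientwise.                  *)
HB.lock Definition lmono (A : comNzRingType) (V : lmodType A) (n : nat)
  (m : 'X_{1..n}) (x : V) : lpoly V n := << x *g m >>.

HB.lock Definition lscale (A : comNzRingType) (V : lmodType A) (n : nat)
    (f : {mpoly A[n]}) (u : lpoly V n) : lpoly V n :=
  \sum_(a <- msupp f) \sum_(b <- msupp u) lmono (mmul a b) (f@_a *: u@_b).

Section LpolyModule.
Variables (A : comNzRingType) (V : lmodType A) (n : nat).
Implicit Types (f g e : {mpoly A[n]}) (u v : lpoly V n) (m : 'X_{1..n}).

Lemma lpolyE u : u = \sum_(m <- msupp u) lmono m u@_m.
Proof. by rewrite lmono.unlock; exact: monalgE. Qed.

Lemma lmono0 m : lmono m (0 : V) = 0.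
Proof. by rewrite lmono.unlock; exact: monalgU0. Qed.

Lemma lmonoD m : {morph @lmono A V n m : x y / x + y}.
Proof. by rewrite lmono.unlock; exact: monalgUD. Qed.

Lemma msupp_lmono m (x : V) : (msupp (lmono m x) `<=` [fset m])%fset.
Proof. by rewrite lmono.unlock; exact: msuppU_le. Qed.

Lemma mcoeff_lmono m m' (x : V) : (lmono m x)@_m' = x *+ (m == m').
Proof. by rewrite lmono.unlock mcoeffU. Qed.

Lemma lscaleEw (d1 d2 : {fset 'X_{1..n}}) f u :
  (msupp f `<=` d1)%fset -> (msupp u `<=` d2)%fset ->
  lscale f u = \sum_(a <- d1) \sum_(b <- d2) lmono (mmul a b) (f@_a *: u@_b).
Proof.
move=> le1 le2; rewrite lscale.unlock (big_fset_incl _ le1) /=.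
  apply/eq_bigr => a _; apply/big_fset_incl => // b _ /mcoeff_outdom ->.
  by rewrite scaler0 lmono0.
move=> a _ /mcoeff_outdom fa; rewrite big1 // => b _.
by rewrite fa scale0r lmono0.
Qed.

Lemma lscaleDr f : {morph @lscale A V n f : u v / u + v}.
Proof.
move=> u v; pose_big_fset 'X_{1..n} E.
rewrite !(@lscaleEw (msupp f) E) ?fsubset_refl //.
  rewrite -big_split /=; apply: eq_bigr => a _.
  rewrite -big_split /=; apply: eq_bigr => b _.
  by rewrite mcoeffD scalerDr lmonoD.
by close.
Qed.

Lemma lscaleDl u : {morph (@lscale A V n)^~ u : f g / f + g}.
Proof.
move=> f g; pose_big_fset 'X_{1..n} E.
rewrite !(@lscaleEw E (msupp u)) ?fsubset_refl //.
  rewrite -big_split /=; apply: eq_bigr => a _.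
  rewrite -big_split /=; apply: eq_bigr => b _.
  by rewrite mcoeffD scalerDl lmonoD.
by close.
Qed.

Lemma lscale0l u : lscale 0 u = 0.
Proof. by rewrite lscale.unlock msupp0 big_seq_fset0. Qed.

Lemma lscale0r f : lscale f (0 : lpoly V n) = 0.
Proof. by rewrite lscale.unlock msupp0 big1 // => a _; rewrite big_seq_fset0. Qed.

Lemma lscaleUU c (x : V) (a b : 'X_{1..n}) :
  lscale << c *g a >> (lmono b x : lpoly V n) = lmono (mmul a b) (c *: x).
Proof.
rewrite (lscaleEw msuppU_le (msupp_lmono _ _)) !big_seq_fset1.
by rewrite mcoeffUU mcoeff_lmono eqxx.
Qed.

Lemma lscale1 : left_id 1 (@lscale A V n).
Proof.
move=> u; rewrite [RHS]lpolyE lscale.unlock msuppU1 big_seq_fset1.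
by apply: eq_bigr => b _; rewrite mcoeffUU scale1r mul1m.
Qed.

Let sumDl u := big_morph ((@lscale A V n)^~ u) (lscaleDl u) (lscale0l u).
Let sumDr f := big_morph (@lscale A V n f) (lscaleDr f) (lscale0r f).

Let lscaleA_mono f g e u :
  (forall c (x : V),
     lscale f (lscale g (lmono c x)) = lscale e (lmono c x)) ->
  lscale f (lscale g u) = lscale e u.
Proof.
by move=> fge; rewrite [u]lpolyE !sumDr; apply: eq_bigr => c _; apply: fge.
Qed.

Lemma lscaleA f g u : lscale f (lscale g u) = lscale (f * g) u.
Proof.
rewrite [f]monalgE mulr_suml !sumDl; apply: eq_bigr => a _.
rewrite [g]monalgE mulr_sumr !sumDl sumDr; apply: eq_bigr => b _.
move: (f@_a) (g@_b) => x y; apply: lscaleA_mono => c z.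
apply: etrans (congr1 (@lscale A V n _) (lscaleUU y z b c)) _.
apply: etrans (lscaleUU x (y *: z) a (mmul b c)) _.
rewrite scalerA mulmA; apply: esym.
apply: etrans (lscaleUU (x * y) z (mmul a b) c).
by apply: (congr1 (fun f => lscale f (lmono c z))); exact: fgmulUU.
Qed.

HB.instance Definition _ :=
  GRing.Zmodule_isLmodule.Build {mpoly A[n]} (lpoly V n)
    lscaleA lscale1 lscaleDr lscaleDl.

End LpolyModule.

Section LambdaCalculus.
Variables (A : comNzRingType).
Implicit Types (V W : lmodType A).

(* The variable lambda_(i+1) of A[lambda_1, ..., lambda_n].  The index is a   *)
(* natural number to allow index arithmetic; it is < n in all uses below, and *)
(* the value 0 out of range is never reached.                                 *)
Definition lvar (n i : nat) : {mpoly A[n]} :=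
  if insub i is Some o then << @ucm 'I_n o >> else 0.

Definition lcst V (n : nat) (v : V) : lpoly V n := lmono mone v.

(* The extension of F : V -> W[lambda_1, ..., lambda_n] that is linear over   *)
(* polynomials in the lambda's.                                               *)
Definition lext V W (n : nat) (F : V -> lpoly W n) (u : lpoly V n) :
    lpoly W n :=
  \sum_(m <- msupp u) (<< m >> : {mpoly A[n]}) *: F u@_m.

Definition lmap V W (n : nat) (f : V -> W) : lpoly V n -> lpoly W n :=
  lext (fun v => lcst n (f v)).

(* Substitution of mu_i for the i-th variable: if u = phi_{lambda}(v), then   *)
(* [lsubst mu u] is phi_{mu}(v).                                              *)
Definition lsubst V (n m : nat) (mu : 'I_n -> {mpoly A[m]}) (u : lpoly V n) :
    lpoly V m :=
  \sum_(b <- msupp u) (\prod_(i < n) mu i ^+ b i) *: lcst m u@_b.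

End LambdaCalculus.

Arguments lvar {A n} i.
Arguments lcst {A V} n v.

(* Maps V^{(x) k} -> V[lambda_1, ..., lambda_(k-1)] are represented by maps   *)
(* on k-tuples, with multilinearity over C part of [conformal_sesquilinear].  *)
Definition lmaps (A : comNzRingType) (V : lmodType A) (k : nat) : Type :=
  k.-tuple V -> lpoly V k.-1.

Definition tupd (T : Type) (k : nat) (v : k.-tuple T) (j : 'I_k) (x : T) :
    k.-tuple T :=
  [tuple if i == j then x else tnth v i | i < k].

Record conformal_sesquilinear (C : fieldType) (V : lmodType {poly C}) (k : nat)
    (phi : lmaps V k) : Prop := ConformalSesquilinear {
  cs_multilinear : forall (v : k.-tuple V) (j : 'I_k) (c : C) (x y : V),
    phi (tupd v j (c%:P *: x + y))
      = c%:P%:MP *: phi (tupd v j x) + phi (tupd v j y);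
  cs_nonlast : forall (v : k.-tuple V) (j : 'I_k), (j < k.-1)%N ->
    phi (tupd v j ('X *: tnth v j)) = - lvar j *: phi v;
  cs_last : forall (v : k.-tuple V) (j : 'I_k), j = k.-1 :> nat ->
    phi (tupd v j ('X *: tnth v j))
      = ('X%:MP + \sum_(0 <= t < k.-1) lvar t) *: phi v
}.

(* Graded C[d]-modules: V is the internal direct sum of the C[d]-submodules   *)
(* [gr d], d in Z.                                                            *)
Record gradedModule (C : fieldType) := GradedModule {
  gm_sort :> lmodType {poly C};
  gr : int -> gm_sort -> Prop;
  gr0 : forall d, gr d 0;
  grP : forall d (a : {poly C}) u v, gr d u -> gr d v -> gr d (a *: u + v);
  gr_span : forall v, exists (s : seq int) (w : int -> gm_sort),
    (forall d, gr d (w d)) /\ v = \sum_(d <- s) w d;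
  gr_direct : forall (s : seq int) (w : int -> gm_sort), uniq s ->
    (forall d, gr d (w d)) -> \sum_(d <- s) w d = 0 ->
    forall d, d \in s -> w d = 0
}.

Definition homogeneous (C : fieldType) (V W : gradedModule C) (e : int)
    (f : V -> W) : Prop :=
  forall d v, gr d v -> gr (d + e) (f v).

Definition lmaps_homogeneous (C : fieldType) (V : gradedModule C) (e : int)
    (k : nat) (phi : lmaps V k) : Prop :=
  forall (d : 'I_k -> int) (v : k.-tuple V),
    (forall i, gr (d i) (tnth v i)) ->
    forall m, gr (\sum_(i < k) d i + e) (phi v)@_m.

(* With j counted from 0 and n = k + l - 1,                                   *)
(*   phi_{lambda_1, ..., lambda_j, lambda_(j+1) + ... + lambda_(j+l),         *)
(*        lambda_(j+l+1), ..., lambda_(n-1)}                                  *)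
(*     (v_1, ..., v_j,                                                        *)
(*      psi_{lambda_(j+1), ..., lambda_(j+l-1)}(v_(j+1), ..., v_(j+l)),       *)
(*      v_(j+l+1), ..., v_n),                                                 *)
(* where for j = k - 1 the subscripts are just lambda_1, ..., lambda_(k-1),   *)
(* as [s] below only ranges over s < k - 1.                                   *)
Definition insertion (A : comNzRingType) (V : lmodType A) (k l : nat)
    (phi : lmaps V k) (psi : lmaps V l) (j n : nat) (v : n.-tuple V) :
    lpoly V n.-1 :=
  lext
    (fun x : V =>
       lsubst
         (fun s : 'I_k.-1 =>
            if (s < j)%N then lvar s
            else if s == j :> nat then \sum_(j <= t < j + l) lvar t
            else lvar (s + l.-1))
         (phi [tuple if (i < j)%N then v`_i
                     else if i == j :> nat then x
                     else v`_(i + l.-1) | i < k]))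
    (lsubst (fun s : 'I_l.-1 => lvar (j + s)) (psi [tuple v`_(j + i) | i < l])).

(* The sign (-1)^d, d in Z, is written (-1) ^+ `|d|, of the same parity. The  *)
(* value of [rho] at k = 0 is irrelevant.                                     *)
Record Ainfty1_conformal (C : fieldType) (V : gradedModule C)
    (rho : forall k, lmaps V k) : Prop := Ainfty1Conformal {
  ai_sesquilinear : forall k, (0 < k)%N -> conformal_sesquilinear (rho k);
  ai_degree : forall k, (0 < k)%N -> lmaps_homogeneous (- 1) (rho k);
  ai_relation : forall n, (0 < n)%N ->
    forall (d : 'I_n -> int) (v : n.-tuple V),
    (forall i, gr (d i) (tnth v i)) ->
    \sum_(1 <= k < n.+1) \sum_(1 <= l < n.+1 | (k + l == n.+1)%N)
      \sum_(j < k)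
        (-1) ^+ `|(\sum_(i < n | (i < j)%N) d i)%R|%N
          *: insertion (rho k) (rho l) j v = 0
}.

(* C[d]-linearity is carried by the type of rho1.                             *)
Record chain_complex (C : fieldType) (V : gradedModule C)
    (rho1 : {linear V -> V}) : Prop := ChainComplex {
  cc_degree : homogeneous (- 1) rho1;
  cc_square : forall v, rho1 (rho1 v) = 0
}.

Record contraction_data (C : fieldType) (V W : gradedModule C)
    (rho1 : {linear V -> V}) (theta1 : {linear W -> W})
    (p : {linear V -> W}) (i : {linear W -> V}) (h : {linear V -> V}) : Prop :=
  ContractionData {
  cd_p_degree : homogeneous 0 p;
  cd_i_degree : homogeneous 0 i;
  cd_h_degree : homogeneous 1 h;
  cd_p_chain : forall v, p (rho1 v) = theta1 (p v);
  cd_i_chain : forall w, i (theta1 w) = rho1 (i w);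
  cd_homotopy : forall v, i (p v) - v = rho1 (h v) + h (rho1 v);
  cd_retract : forall w, p (i w) = w
}.

Definition two_maps (A : comNzRingType) (V : lmodType A) (rho1 : V -> V)
    (rho2 : lmaps V 2) (k : nat) : lmaps V k :=
  match k with
  | 1 => fun v => lcst 0 (rho1 v`_0)
  | 2 => rho2
  | _ => fun _ => 0
  end.

Section Transfer.
Variables (A : comNzRingType) (V : lmodType A).
Variables (rho2 : lmaps V 2) (h : V -> V).

(* rho_2 (phi (x) psi), of arity n = a + b.                                   *)
Definition rho2_tensor (a b : nat) (phi : lmaps V a) (psi : lmaps V b)
    (n : nat) : lmaps V n := fun v =>
  lext
    (fun x : V =>
       lext
         (fun y : V =>
            lsubst (fun _ : 'I_1 => \sum_(0 <= t < a) lvar t)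
              (rho2 [tuple x; y]))
         (lsubst (fun s : 'I_b.-1 => lvar (a + s))
            (psi [tuple v`_(a + i) | i < b])))
    (lsubst (fun s : 'I_a.-1 => lvar s) (phi [tuple v`_i | i < a])).

(* h o r_k, with the convention h o r_1 = id.                                 *)
Definition h_comp (r : forall k, lmaps V k) (k : nat) : lmaps V k := fun v =>
  if k == 1%N then lcst k.-1 v`_0 else lmap h (r k v).

Arguments h_comp : clear implicits.

Fixpoint transfer_r_rec (N k : nat) : lmaps V k := fun v =>
  if N is N'.+1 then
    \sum_(1 <= a < k) \sum_(1 <= b < k | (a + b == k)%N)
      rho2_tensor (h_comp (transfer_r_rec N') a) (h_comp (transfer_r_rec N') b)
        v
  else 0.

Arguments transfer_r_rec : clear implicits.

(* The recursion depth k suffices for r_k: see [transfer_rE].                 *)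
Definition transfer_r (k : nat) : lmaps V k := transfer_r_rec k k.

Arguments transfer_r : clear implicits.

Lemma h_comp_ext (r r' : forall k, lmaps V k) k :
  r k =1 r' k -> h_comp r k =1 h_comp r' k.
Proof. by move=> rr' v; rewrite /h_comp rr'. Qed.

Lemma rho2_tensor_ext a b (phi phi' : lmaps V a) (psi psi' : lmaps V b) n :
  phi =1 phi' -> psi =1 psi' ->
  rho2_tensor phi psi (n := n) =1 rho2_tensor phi' psi' (n := n).
Proof. by move=> e1 e2 v; rewrite /rho2_tensor e1 e2. Qed.

Lemma transfer_r_rec_fuel N M k :
  (k <= N)%N -> (k <= M)%N -> transfer_r_rec N k =1 transfer_r_rec M k.
Proof.
elim: N M k => [|N IHN] [|M] k //=.
- by rewrite leqn0 => /eqP-> _ v; rewrite big_geq.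
- by move=> _; rewrite leqn0 => /eqP-> v; rewrite big_geq.
move=> kN kM v; apply: eq_big_nat => a /andP[_ ak].
rewrite big_nat_cond [RHS]big_nat_cond.
apply: eq_bigr => b /andP[/andP[_ bk] _].
by apply: rho2_tensor_ext; apply: h_comp_ext; apply: IHN;
  rewrite -ltnS (leq_trans _ kN, leq_trans _ kM).
Qed.

Lemma transfer_rE k (v : k.-tuple V) :
  transfer_r k v = \sum_(1 <= a < k) \sum_(1 <= b < k | (a + b == k)%N)
    rho2_tensor (h_comp transfer_r a) (h_comp transfer_r b) v.
Proof.
rewrite /transfer_r; case: k v => [|k] v; first by rewrite /= !big_geq.
apply: eq_big_nat => a /andP[_ ak].
rewrite big_nat_cond [RHS]big_nat_cond.
apply: eq_bigr => b /andP[/andP[_ bk] _].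
by apply: rho2_tensor_ext; apply: h_comp_ext; apply: transfer_r_rec_fuel.
Qed.

End Transfer.

Arguments h_comp {A V} h r k v.
Arguments transfer_r_rec {A V} rho2 h N k v.
Arguments transfer_r {A V} rho2 h k v.

Definition transfer_theta (A : comNzRingType) (V W : lmodType A)
    (rho2 : lmaps V 2) (theta1 : W -> W) (p : V -> W) (i : W -> V) (h : V -> V)
    (k : nat) : lmaps W k := fun w =>
  if k == 1%N then lcst k.-1 (theta1 w`_0)
  else lmap p (transfer_r rho2 h k (map_tuple i w)).

(* Main.v *)
(* Put s_k = r_k o i^{(x) k} and g_k = h o s_k, with g_1 = i, so that         *)
(* theta_k = p o s_k for k >= 2. One shows by induction on n that             *)
(*   rho_1 s_n + sum +- s_k (id, ..., theta_l, ..., id) = 0;                  *)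
(* applying p gives the relations for theta. In the induction step, rho_1 s_n *)
(* is expanded by the Leibniz rule for rho_2. The homotopy identity and the   *)
(* induction hypothesis give                                                  *)
(*   rho_1 g_a = sum +- g_k (id, ..., theta_l, ..., id) - s_a  for a < n,     *)
(* the first terms add up to the desired ones, and the terms with s_a cancel  *)
(* by associativity of rho_2.                                                 *)
(*   The lambdas play no role in this argument. Extend every map linearly to  *)
(* V[Lambda] and evaluate it on words whose letters carry, besides a degree   *)
(* and a vector of V[Lambda], the polynomial to be substituted for lambda_j.  *)
(* Composition of sesquilinear maps becomes replacement of a subword by one   *)
(* letter labelled by the sum of the labels.                                  *)

From HB Require Import structures.
Require Import Defs.
From mathcomp Require Import all_boot all_order all_algebra reals complex.
From mathcomp Require Import zify finmap xfinmap monalg.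
Set Implicit Arguments.
Unset Strict Implicit.
Unset Printing Implicit Defensive.
Import GRing.Theory.
Local Open Scope ring_scope.

(** * Homotopy transfer on words *)

(** On words the theorem becomes a statement about deconcatenation. Let D be
    [insertions word_theta], which sums, with Koszul signs, over all replacements of a nonempty
    subword by the value of theta on it; the A_infty-relation is D [word_theta] = 0. The recursion
    for r reads r(w) = sum over w = uv of m(g(u), g(v)), with r = [word_r] and g = [word_hr]. Now D
    is a coderivation for deconcatenation ([insertions_splits]), and deconcatenation is
    coassociative ([splitsA]). With the Leibniz rule for m and the homotopy identity
    ([word_hr_morphism]), induction on the length gives rho_1 r + D r = 0 ([word_r_differential]):
    the terms left over are the two bracketings of three factors, which cancel by associativity.
    Applying p gives [word_transfer].

    To return to the lambdas, [bracket_differential] and [bracket_assoc] extract the Leibniz rule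
    and associativity of the bracket from the relations with two and three arguments.
    [lsubst_transfer_r] identifies the r_k with [word_r], and [insertion_transfer_theta] identifies
    each summand of the relation for theta with a summand of D. Sesquilinearity of theta is an
    induction over splittings that tracks the factor produced by d ([word_theta_scale],
    [lword_theta_deriv]), and its degree comes from [word_theta_degree]. *)

Lemma odd_absD (d e : int) : odd `|d + e| = odd `|d| (+) odd `|e|.
Proof. lia. Qed.

Lemma morphD0 (E F : zmodType) (f : E -> F) :
  {morph f : x y / x + y} -> f 0 = 0.
Proof. by move=> fD; apply: (addrI (f 0)); rewrite -fD !addr0. Qed.

(** * Koszul signs *)

Section Signs.
Variable E : zmodType.
Implicit Types (x y : E) (d e : int).

(** A conditional negation, so that no scalar action on [E] is needed. *)
Definition ksign d x := if odd `|d| then - x else x.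

Lemma ksign0l x : ksign 0 x = x. Proof. by []. Qed.

Lemma ksignDl d e x : ksign (d + e) x = ksign d (ksign e x).
Proof. by rewrite /ksign odd_absD; do 2!case: odd => //=; rewrite opprK. Qed.

Lemma ksignDr d : {morph ksign d : x y / x + y}.
Proof. by move=> x y; rewrite /ksign; case: odd; rewrite // opprD. Qed.

Lemma ksignN d x : ksign d (- x) = - ksign d x.
Proof. by rewrite /ksign; case: odd. Qed.

Lemma ksign0r d : ksign d 0 = 0.
Proof. by rewrite /ksign oppr0 if_same. Qed.

End Signs.

Lemma morph_ksign (E F : zmodType) (f : E -> F) d : {morph f : x y / x + y} ->
  {morph f : x / ksign d x}.
Proof.
move=> fD x; rewrite /ksign; case: odd => //.
have f0 := morphD0 fD.
by apply: (addrI (f x)); rewrite -fD !subrr.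
Qed.

(** * Sums over the factorisations of a word into two *)

Section Splits.
Variable T : Type.
Implicit Types (w : seq T) (M N : zmodType).

(** The prefix is accumulated in [Psi], so that identities follow by induction on the word. Both
    factors may be empty. *)
Fixpoint splits M (Psi : seq T -> seq T -> M) w : M :=
  if w is x :: w' then Psi [::] w + splits (fun u => Psi (x :: u)) w'
  else Psi [::] [::].

Lemma splitsE M (Psi : seq T -> seq T -> M) w :
  splits Psi w = \sum_(0 <= a < (size w).+1) Psi (take a w) (drop a w).
Proof.
elim: w Psi => [|x w IH] Psi /=; first by rewrite big_nat1.
by rewrite big_nat_recl //= IH.
Qed.

Lemma eq_splits M (Psi Psi' : seq T -> seq T -> M) w :
  (forall u v, u ++ v = w -> Psi u v = Psi' u v) ->
  splits Psi w = splits Psi' w.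
Proof.
move=> e; rewrite !splitsE; apply: eq_bigr => a _; apply: e.
exact: cat_take_drop.
Qed.

Lemma splitsD M (Psi Psi' : seq T -> seq T -> M) w :
  splits (fun u v => Psi u v + Psi' u v) w = splits Psi w + splits Psi' w.
Proof. by rewrite !splitsE big_split. Qed.

Lemma splits_morph M N (f : M -> N) (Psi : seq T -> seq T -> M) w :
  {morph f : x y / x + y} ->
  f (splits Psi w) = splits (fun u v => f (Psi u v)) w.
Proof.
move=> fD; have f0 := morphD0 fD.
by rewrite !splitsE (big_morph f fD f0).
Qed.

(** Coassociativity of deconcatenation: either order of cutting produces each factorisation into
    three factors once. *)
Lemma splitsA M (X : seq T -> seq T -> seq T -> M) w :
  splits (fun u => splits (X u)) w =
  splits (fun v c => splits (fun a b => X a b c) v) w.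
Proof.
elim: w X => [|x w IH] X //=.
by rewrite splitsD IH addrA.
Qed.

(** The cut falls either before or after [x]. *)
Lemma splits_mid M (Psi : seq T -> seq T -> M) u x v :
  splits Psi (u ++ x :: v) = splits (fun a b => Psi a (b ++ x :: v)) u
                             + splits (fun a b => Psi (u ++ x :: a) b) v.
Proof.
elim: u Psi => [|y u IH] Psi //=.
by rewrite (IH (fun a => Psi (y :: a))) addrA.
Qed.

End Splits.

(* A letter is an argument of a sesquilinear map, with its degree and with the*)
(* polynomial substituted for its lambda. Replacing a subword by its value    *)
(* adds up the labels, which is the substitution rule of the A_infty-relation;*)
(* the label of the last letter is never used.                                *)
Section Insertions.
Variables (B E : zmodType).
Local Notation letter := (int * B * E)%type.
Implicit Types (w u v : seq letter) (M N : zmodType).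

Definition wdeg w : int := \sum_(x <- w) x.1.1.
Definition wlab w : B := \sum_(x <- w) x.1.2.

Lemma wdeg_cat u v : wdeg (u ++ v) = wdeg u + wdeg v.
Proof. exact: big_cat. Qed.

Lemma wdeg_cons x v : wdeg (x :: v) = x.1.1 + wdeg v.
Proof. exact: big_cons. Qed.

Lemma wlab_cat u v : wlab (u ++ v) = wlab u + wlab v.
Proof. exact: big_cat. Qed.

Lemma wlab_cons x v : wlab (x :: v) = x.1.2 + wlab v.
Proof. exact: big_cons. Qed.

Variable T : seq letter -> E.

Definition contract w : letter := (wdeg w - 1, wlab w, T w).

(* The left-hand side of the A_infty[1]-relation, with [Phi] as outer map.    *)
Fixpoint insertions M (Phi : seq letter -> M) w : M :=
  if w is x :: w' then
    splits (fun u v => Phi (contract (x :: u) :: v)) w'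
      + ksign x.1.1 (insertions (fun u => Phi (x :: u)) w')
  else 0.

(** The form to be matched with the A_infty-relation: [j] is the start of the replaced subword and
    [l.+1] its length. *)
Lemma insertionsE M (Phi : seq letter -> M) w :
  insertions Phi w = \sum_(0 <= j < size w)
    ksign (wdeg (take j w)) (\sum_(0 <= l < size w - j)
       Phi (take j w ++ contract (take l.+1 (drop j w)) :: drop (j + l.+1) w)).
Proof.
elim: w Phi => [|x w IH] Phi /=; first by rewrite big_geq.
rewrite big_nat_recl // take0 /wdeg big_nil ksign0l subn0 drop0 splitsE.
congr (_ + _); rewrite IH (big_morph _ (ksignDr x.1.1) (ksign0r _ _)).
by apply: eq_bigr => j _; rewrite big_cons ksignDl.
Qed.

Lemma insertions_morph M N (f : M -> N) (Phi : seq letter -> M) w :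
  {morph f : x y / x + y} ->
  insertions (fun u => f (Phi u)) w = f (insertions Phi w).
Proof.
move=> fD; have f0 := morphD0 fD.
elim: w Phi => [|x w IH] Phi //=.
by rewrite fD (morph_ksign _ fD) (splits_morph _ _ fD) IH.
Qed.

Lemma insertionsD M (Phi Phi' : seq letter -> M) w :
  insertions (fun u => Phi u + Phi' u) w = insertions Phi w + insertions Phi' w.
Proof.
elim: w Phi Phi' => [|x w IH] Phi Phi' /=; first by rewrite addr0.
by rewrite IH splitsD ksignDr addrACA.
Qed.

(** Contraction preserves the sum of the labels, so a factor that depends on [wlab] only is constant
    under [insertions]. *)
Lemma eq_insertions M (Phi Phi' : seq letter -> M) w :
  (forall u, wlab u = wlab w -> Phi u = Phi' u) ->
  insertions Phi w = insertions Phi' w.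
Proof.
elim: w Phi Phi' => [|x w IH] Phi Phi' e //=; congr (_ + ksign _ _).
  by apply: eq_splits => u v uv; apply: e;
    rewrite !wlab_cons /= wlab_cons -uv wlab_cat addrA.
by apply: IH => u uw; apply: e; rewrite !wlab_cons uw.
Qed.

Lemma insertions0 M (Phi : seq letter -> M) w :
  (forall u, u != [::] -> Phi u = 0) -> insertions Phi w = 0.
Proof.
elim: w Phi => [|x w IH] Phi Phi0 //=.
rewrite IH => [|u _]; last by apply: Phi0.
by rewrite ksign0r addr0 splitsE big1 // => a _; apply: Phi0.
Qed.

(** The coderivation property: a cut of a contracted word never passes through the new letter, so it
    is a cut of [w] with the contracted subword on one side. Moving the contraction past [u] costs
    the Koszul sign. *)
Lemma insertions_splits M (Psi : seq letter -> seq letter -> M) w :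
  insertions (splits Psi) w =
  splits (fun u v => insertions (Psi^~ v) u
                       + ksign (wdeg u) (insertions (Psi u) v)) w.
Proof.
elim: w Psi => [|x w IH] Psi /=; first by rewrite ksign0r addr0.
rewrite /wdeg big_nil ksign0l add0r -!addrA.
rewrite splitsD insertionsD ksignDr -!addrA; congr (_ + _).
rewrite addrCA; congr (_ + _).
rewrite splitsA IH (splits_morph _ _ (ksignDr _)) -splitsD.
by apply: eq_splits => u v _; rewrite big_cons -/(wdeg _) ksignDr ksignDl addrA.
Qed.

End Insertions.

(** * The transfer theorem for an abstract product [m] with labels *)

Section AbstractTransfer.
Variables (B E E' : zmodType) (m : B -> E -> E -> E).
Variables (rho1 : {additive E -> E}) (theta1 : {additive E' -> E'}).
Variables (p : {additive E -> E'}) (i : {additive E' -> E}).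
Variable h : {additive E -> E}.
Variables (gE : int -> E -> Prop) (gE' : int -> E' -> Prop) (K : B -> Prop).
Local Notation letter := (int * B * E')%type.
Implicit Types (w u v : seq letter).

Definition word_single (F : zmodType) (f : E' -> F) w : F :=
  if w is [:: x] then f x.2 else 0.

(* The splittings with an empty factor contribute 0, by [word_hr_nil]. *)
Fixpoint word_r_rec (N : nat) w : E :=
  if N is N'.+1 then
    splits (fun u v => m (wlab u) (word_single i u + h (word_r_rec N' u))
                                  (word_single i v + h (word_r_rec N' v))) w
  else 0.

Definition word_r w := word_r_rec (size w) w.
Definition word_hr w := word_single i w + h (word_r w).
Definition word_theta w := word_single theta1 w + p (word_r w).

Hypothesis mDl : forall b y, {morph m b ^~ y : x x' / x + x'}.
Hypothesis mDr : forall b x, {morph m b x : y y' / y + y'}.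

Let m0l b y : m b 0 y = 0.
Proof. exact: morphD0 (mDl b y). Qed.

Let m0r b x : m b x 0 = 0.
Proof. exact: morphD0 (mDr b x). Qed.

Let mNl b x y : m b (- x) y = - m b x y.
Proof. by apply: (addrI (m b x y)); rewrite -mDl !subrr m0l. Qed.

Let mNr b x y : m b x (- y) = - m b x y.
Proof. by apply: (addrI (m b x y)); rewrite -mDr !subrr m0r. Qed.

Lemma word_r_recS N w : word_r_rec N.+1 w =
  splits (fun u v => m (wlab u) (word_single i u + h (word_r_rec N u))
                                (word_single i v + h (word_r_rec N v))) w.
Proof. by []. Qed.

Lemma word_r_rec_nil N : word_r_rec N [::] = 0.
Proof. by elim: N => //= N IH; rewrite IH raddf0 addr0 m0l. Qed.

(** If both factors of a splitting are nonempty they are shorter than the word; otherwise the term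
    is 0. *)
Lemma word_r_rec_fuel N N' w :
  (size w <= N)%N -> (size w <= N')%N -> word_r_rec N w = word_r_rec N' w.
Proof.
elim: N N' w => [|N IH] [|N'] w.
- by [].
- by move=> + _; rewrite leqn0 size_eq0 => /eqP->; rewrite !word_r_rec_nil.
- by move=> _; rewrite leqn0 size_eq0 => /eqP->; rewrite !word_r_rec_nil.
move=> lN lN'; rewrite !word_r_recS; apply: eq_splits => u v uv.
have sw : size w = (size u + size v)%N by rewrite -uv size_cat.
case: u v uv sw => [|x u] [|y v] uv sw.
- by rewrite !word_r_rec_nil.
- by rewrite !word_r_rec_nil raddf0 addr0 !m0l.
- by rewrite !word_r_rec_nil raddf0 addr0 !m0r.
by rewrite !(IH N') //; move: lN lN'; rewrite sw /=; lia.
Qed.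

Lemma word_rE w :
  word_r w = splits (fun u v => m (wlab u) (word_hr u) (word_hr v)) w.
Proof.
rewrite /word_r -(@word_r_rec_fuel (size w).+1) // word_r_recS.
apply: eq_splits => u v <-.
rewrite /word_hr /word_r size_cat.
by rewrite (@word_r_rec_fuel (size u + size v)%N (size u) u) ?leq_addr //
  (@word_r_rec_fuel (size u + size v)%N (size v) v) ?leq_addl.
Qed.

Lemma word_r_nil : word_r [::] = 0.
Proof. by []. Qed.

Lemma word_hr_nil : word_hr [::] = 0.
Proof. by rewrite /word_hr word_r_nil raddf0 addr0. Qed.

Lemma word_r1 x : word_r [:: x] = 0.
Proof. by rewrite word_rE /= word_hr_nil m0l m0r addr0. Qed.

Lemma word_hr1 x : word_hr [:: x] = i x.2.
Proof. by rewrite /word_hr word_r1 raddf0 addr0. Qed.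

Lemma word_hr_r w : size w != 1%N -> word_hr w = h (word_r w).
Proof. by rewrite /word_hr; case: w => [|x [|y w]] //= _; rewrite add0r. Qed.

Lemma word_theta1 x : word_theta [:: x] = theta1 x.2.
Proof. by rewrite /word_theta word_r1 raddf0 addr0. Qed.

Lemma word_theta_r w : size w != 1%N -> word_theta w = p (word_r w).
Proof. by rewrite /word_theta; case: w => [|x [|y w]] //= _; rewrite add0r. Qed.

(* [K] selects the labels at which the relations between [rho1] and [m] are   *)
(* assumed to hold.                                                           *)
Definition valid w := forall x, x \in w -> gE' x.1.1 x.2 /\ K x.1.2.

Lemma valid_catl u v : valid (u ++ v) -> valid u.
Proof. by move=> h0 x xu; apply: h0; rewrite mem_cat xu. Qed.

Lemma valid_catr u v : valid (u ++ v) -> valid v.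
Proof. by move=> h0 x xu; apply: h0; rewrite mem_cat xu orbT. Qed.

Hypothesis K0 : K 0.
Hypothesis KD : forall a b, K a -> K b -> K (a + b).

Lemma valid_wlab w : valid w -> K (wlab w).
Proof.
elim: w => [|x w IH] vw; first by rewrite /wlab big_nil.
rewrite wlab_cons; apply: KD; first by apply: (vw x _).2; exact: mem_head.
by apply: IH; exact: (@valid_catr [:: x]).
Qed.

Hypothesis gE0 : forall d, gE d 0.
Hypothesis gED : forall d x y, gE d x -> gE d y -> gE d (x + y).
Hypothesis gm : forall b d e x y, K b ->
  gE d x -> gE e y -> gE (d + e - 1) (m b x y).
Hypothesis gh : forall d x, gE d x -> gE (d + 1) (h x).
Hypothesis gi : forall d x, gE' d x -> gE d (i x).

Lemma word_r_degree w : valid w -> gE (wdeg w - 1) (word_r w).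
Proof.
have [n] := ubnP (size w); elim: n w => // n IH w; rewrite ltnS => sw vw.
rewrite word_rE splitsE big_seq; apply: (big_ind (gE (wdeg w - 1)));
  first exact: gE0.
  by move=> x y; exact: gED.
move=> a; rewrite mem_index_iota ltnS => /andP[_ aw].
have hr u : valid u -> (size u < size w)%N -> gE (wdeg u) (word_hr u).
  move=> vu su; rewrite /word_hr; apply: gED.
    case: u vu su => [|x [|y u]] //= vu _.
    rewrite wdeg_cons /wdeg big_nil addr0; apply: gi.
    by apply: (vu x _).1; exact: mem_head.
  by rewrite -[wdeg u](subrK 1); apply: gh; apply: IH => //;
    exact: leq_trans sw.
case: (posnP a) => [->|a0]; first by rewrite take0 word_hr_nil m0l.
have [->|aw'] := eqVneq a (size w); first by rewrite drop_size word_hr_nil m0r.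
have saw : (a < size w)%N by rewrite ltn_neqAle aw'.
move: (vw); rewrite -{1}(cat_take_drop a w) => vv.
rewrite -{1}(cat_take_drop a w) wdeg_cat; apply: gm.
- exact: valid_wlab (valid_catl vv).
- by apply: hr (valid_catl vv) _; rewrite size_takel.
- by apply: hr (valid_catr vv) _; rewrite size_drop; lia.
Qed.

Lemma word_hr_degree w : valid w -> gE (wdeg w) (word_hr w).
Proof.
move=> vw; rewrite /word_hr; apply: gED.
  case: w vw => [|x [|y u]] //= vu.
  rewrite wdeg_cons /wdeg big_nil addr0; apply: gi.
  by apply: (vu x _).1; exact: mem_head.
by rewrite -[wdeg w](subrK 1); apply: gh; exact: word_r_degree.
Qed.

Lemma word_theta_degree w :
  (forall d, gE' d 0) ->
  (forall d x y, gE' d x -> gE' d y -> gE' d (x + y)) ->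
  (forall d x, gE d x -> gE' d (p x)) ->
  (forall d x, gE' d x -> gE' (d - 1) (theta1 x)) ->
  valid w -> gE' (wdeg w - 1) (word_theta w).
Proof.
move=> g0 gD gp gt vw; apply: gD; last by apply: gp; exact: word_r_degree.
case: w vw => [|x [|y w]] vw //=; rewrite wdeg_cons /wdeg big_nil addr0.
by apply: gt; apply: (vw x _).1; exact: mem_head.
Qed.

Hypothesis rho1_m : forall b d e x y, K b -> gE d x -> gE e y ->
  rho1 (m b x y) + m b (rho1 x) y + ksign d (m b x (rho1 y)) = 0.
Hypothesis mA : forall b c d e f x y z, K b -> K c ->
  gE d x -> gE e y -> gE f z ->
  m (b + c) (m b x y) z + ksign d (m b x (m c y z)) = 0.
Hypothesis theta1_square : forall x, theta1 (theta1 x) = 0.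
Hypothesis p_chain : forall x, p (rho1 x) = theta1 (p x).
Hypothesis i_chain : forall x, i (theta1 x) = rho1 (i x).
Hypothesis homotopy : forall x, i (p x) - x = rho1 (h x) + h (rho1 x).

Local Notation D := (insertions word_theta).

Lemma insertions_m b (Phi : seq letter -> E) y w :
  D (fun u => m (b + wlab u) (Phi u) y) w = m (b + wlab w) (D Phi w) y.
Proof.
by rewrite -(@insertions_morph _ _ _ _ _ (m (b + wlab w) ^~ y)) //;
  apply: eq_insertions => u ->.
Qed.

(** Only the contraction of the whole word leaves a single letter. *)
Lemma insertions_single (F : zmodType) (f : {additive E' -> F}) w : w != [::] ->
  D (word_single f) w = f (word_theta w).
Proof.
case: w => //= x w _; rewrite -[RHS]addr0; congr (_ + _).
  rewrite splitsE big_nat_recr //= drop_size take_size big1_seq ?add0r // => a.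
  rewrite mem_index_iota /= => aw.
  by case E0: drop => [|y s] //; move/(congr1 size): E0;
    rewrite size_drop /=; lia.
by rewrite (_ : insertions _ _ _ = 0) ?ksign0r //; apply: insertions0; case.
Qed.

(* The maps h o r_k o i form a morphism of A_infty-algebras. *)
Lemma word_hr_morphism w : w != [::] -> rho1 (word_r w) + D word_r w = 0 ->
  rho1 (word_hr w) + word_r w = D word_hr w.
Proof.
move=> w0 rw.
rewrite /word_hr insertionsD insertions_single //.
rewrite (insertions_morph _ _ _ (raddfD h)).
have -> : D word_r w = - rho1 (word_r w) by apply/eqP;
  rewrite -addr_eq0 addrC rw.
(* At [word_r w] the homotopy identity trades [i p - h rho1] for [id + rho1 h]. *)
have := homotopy (word_r w); rewrite /word_theta !raddfD /= raddfN => hw.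
rewrite -!addrA; congr (_ + _).
  by case: w w0 {rw hw} => [|x [|y w]] //= _; rewrite ?raddf0 ?i_chain.
move/eqP: hw; rewrite subr_eq => /eqP->.
by rewrite [_ + _ + word_r w]addrAC addrK.
Qed.

(* After the Leibniz rule and the induction hypothesis, the terms with a      *)
(* contracted letter recombine into [- D word_r w], and the others cancel by  *)
(* associativity of [m].                                                      *)
Lemma word_r_differential w : valid w -> rho1 (word_r w) + D word_r w = 0.
Proof.
have [n] := ubnP (size w); elim: n w => // n IH w; rewrite ltnS => sw vw.
have hr u : valid u -> (size u < size w)%N ->
    rho1 (word_hr u) = D word_hr u - word_r u.
  move=> vu su; have [->|u0] := eqVneq u [::].
    by rewrite /= word_hr_nil word_r_nil !raddf0 addr0.
  rewrite -(word_hr_morphism u0) ?addrK //.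
  by apply: IH => //; exact: leq_trans sw.
(* The terms [- word_r] of [hr], which the Leibniz rule returns with a plus sign. *)
pose t (u v : seq letter) :=
  m (wlab u) (word_r u) (word_hr v) + ksign (wdeg u) (m (wlab u) (word_hr u)
    (word_r v)).
have -> : rho1 (word_r w) + D word_r w = splits t w.
  rewrite [word_r w]word_rE (splits_morph _ _ (raddfD rho1)).
  rewrite (@eq_insertions _ _ _ _ word_r (splits (fun u v =>
    m (wlab u) (word_hr u) (word_hr v)))); last by move=> u _; exact: word_rE.
  rewrite insertions_splits -splitsD; apply: eq_splits => u v uv.
  have vu : valid u by apply: (@valid_catl u v); rewrite uv.
  have vv : valid v by apply: (@valid_catr u v); rewrite uv.
  have eD : D (fun u' => m (wlab u') (word_hr u') (word_hr v)) u
       = m (wlab u) (D word_hr u) (word_hr v).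
    rewrite -[wlab u in RHS]add0r -insertions_m; apply: eq_insertions => u' _.
    by rewrite add0r.
  rewrite eD (insertions_morph _ _ _ (mDr (wlab u) (word_hr u))).
  have /eqP := rho1_m (valid_wlab vu) (word_hr_degree vu) (word_hr_degree vv).
  rewrite -addrA addr_eq0 => /eqP->; rewrite opprD.
  (* If one factor is empty, the other is as long as [w] and out of reach of the induction
     hypothesis; but these terms are 0. *)
  have [u0|u0] := eqVneq u [::].
    by rewrite /t u0 /= word_hr_nil word_r_nil !raddf0 !m0l !ksign0r !addr0
      ?oppr0 ?addr0.
  have [v0|v0] := eqVneq v [::].
    by rewrite /t v0 /= word_hr_nil word_r_nil !raddf0 !m0r !ksign0r !addr0
      ?oppr0 ?addr0.
  move: u0 v0; rewrite -!size_eq0 => u0 v0.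
  have := uv; move/(congr1 size); rewrite size_cat => suv.
  rewrite !hr //; last 2 first.
  - by rewrite -suv -{1}[size v]add0n ltn_add2r lt0n.
  - by rewrite -suv -{1}[size u]addn0 ltn_add2l lt0n.
  rewrite mDl mDr mNl mNr ksignDr ksignN !opprB addrACA.
  by rewrite -/(word_hr _) !subrK.
(* Expanding [word_r] inside [t] gives the two bracketings of each factorisation into three, which
   cancel by [mA]. *)
pose X (a b c : seq letter) :=
  m (wlab a + wlab b) (m (wlab a) (word_hr a) (word_hr b)) (word_hr c).
pose Y (a b c : seq letter) :=
  ksign (wdeg a) (m (wlab a) (word_hr a) (m (wlab b) (word_hr b) (word_hr c))).
transitivity (splits (fun u => splits (X u)) w + splits (fun u =>
  splits (Y u)) w).
  rewrite splitsD splitsA; congr (_ + _); apply: eq_splits => u v _.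
    rewrite word_rE (splits_morph _ _ (fun x y =>
      mDl (wlab u) (word_hr v) x y)).
    by apply: eq_splits => a b <-; rewrite wlab_cat.
  rewrite word_rE (splits_morph _ _ (mDr _ _)).
  by rewrite (splits_morph _ _ (ksignDr _)); apply: eq_splits.
rewrite -splitsD splitsE big1 // => a _;
  rewrite -splitsD splitsE big1 // => b _.
have vw' : valid ((take a w ++ take b (drop a w)) ++ drop b (drop a w)).
  by rewrite -catA !cat_take_drop.
have vu := valid_catl (valid_catl vw'); have vv := valid_catr (valid_catl vw').
have vz := valid_catr vw'.
by apply: mA (valid_wlab _) (valid_wlab _) (word_hr_degree _)
  (word_hr_degree _) (word_hr_degree _).
Qed.

(** The image under [p] of [word_r_differential]; a word of one letter also contributes the square
    of [theta1]. *)
Lemma word_transfer w : valid w -> w != [::] -> D word_theta w = 0.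
Proof.
move=> vw w0.
rewrite /word_theta insertionsD insertions_single // -/word_theta.
rewrite (insertions_morph _ _ _ (raddfD p)) /word_theta !raddfD /=.
rewrite -p_chain -addrA -raddfD word_r_differential // raddf0 addr0.
by case: w w0 {vw} => [|x [|y w]] //= _; rewrite ?raddf0 ?theta1_square.
Qed.

End AbstractTransfer.

(** * Behaviour of the transferred maps in a single letter *)

Section WordLinearity.
Variables (R : comNzRingType) (E E' : lmodType R) (m : R -> E -> E -> E).
Variables (theta1 : {linear E' -> E'}) (p : {linear E -> E'}).
Variables (i : {linear E' -> E}) (h : {linear E -> E}) (K : R -> Prop).
Hypothesis mDl : forall b y, {morph m b ^~ y : x x' / x + x'}.
Hypothesis mDr : forall b x, {morph m b x : y y' / y + y'}.
Local Notation letter := (int * R * E')%type.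
Implicit Types (w u v : seq letter).
Local Notation r := (word_r m i h).
Local Notation hr := (word_hr m i h).
Local Notation theta := (word_theta m theta1 p i h).

Lemma word_singleD (F : lmodType R) (f : {linear E' -> F}) u v d b x y :
  word_single f (u ++ (d, b, x + y) :: v) =
  word_single f (u ++ (d, b, x) :: v) + word_single f (u ++ (d, b, y) :: v).
Proof.
by case: u v => [|z [|z' u]] [|t v] /=; rewrite ?linearD ?addr0.
Qed.

(** Induction on the number of other letters: in each splitting, [m] is additive in the factor that
    contains the letter. The two claims go together because r recurses through h o r. *)
Lemma word_hrD u v d b x y :
  hr (u ++ (d, b, x + y) :: v)
    = hr (u ++ (d, b, x) :: v) + hr (u ++ (d, b, y) :: v) /\
  r (u ++ (d, b, x + y) :: v)
    = r (u ++ (d, b, x) :: v) + r (u ++ (d, b, y) :: v).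
Proof.
have [n] := ubnP (size u + size v); elim: n u v => // n IH u v.
rewrite ltnS => sn.
suff rD : r (u ++ (d, b, x + y) :: v)
    = r (u ++ (d, b, x) :: v) + r (u ++ (d, b, y) :: v).
  by split=> //; rewrite /word_hr rD raddfD word_singleD addrACA.
rewrite !(word_rE _ _ mDl mDr) !splits_mid [RHS]addrACA -!splitsD.
have m0l c z : m c 0 z = 0 by apply: (morphD0 (mDl c z)).
have m0r c z : m c z 0 = 0 by apply: (morphD0 (mDr c z)).
congr (_ + _); apply: eq_splits => a a' aa'.
  have [->|a0] := eqVneq a [::];
    first by rewrite (word_hr_nil m i h) !m0l addr0.
  rewrite (IH _ _ _).1 ?mDr //; apply: leq_trans sn.
  by rewrite -aa' size_cat -addnA -[ltnLHS]add0n ltn_add2r lt0n size_eq0.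
have [->|a0] := eqVneq a' [::]; first by rewrite (word_hr_nil m i h) !m0r addr0.
rewrite (IH _ _ _).1 ?mDl; first by rewrite !wlab_cat !wlab_cons.
apply: leq_trans sn.
by rewrite -aa' size_cat addnA -[ltnLHS]addn0 ltn_add2l lt0n size_eq0.
Qed.

Lemma word_thetaD u v d b x y :
  theta (u ++ (d, b, x + y) :: v)
    = theta (u ++ (d, b, x) :: v) + theta (u ++ (d, b, y) :: v).
Proof.
by rewrite /word_theta (word_hrD _ _ _ _ _ _).2 raddfD word_singleD addrACA.
Qed.

Section Scale.
(* [c u v] is the factor by which the value on [u ++ (d, b, x) :: v] changes  *)
(* when x is multiplied by s. It is s itself when [m] is bilinear over s, but *)
(* depends on u and v for s = d, by sesquilinearity.                          *)
Variables (d : int) (b s : R) (x : E') (c : seq letter -> seq letter -> R).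
Let L z u v := u ++ (d, b, z) :: v.
Definition klabels w := forall y, y \in w -> K y.1.2.
Hypothesis cs : c [::] [::] = s.
Hypothesis cl : forall a a' v X Y, klabels (a ++ a') ->
  m (wlab a) X (c a' v *: Y) = c (a ++ a') v *: m (wlab a) X Y.
Hypothesis cr : forall u a a' X Y, klabels u -> klabels (a ++ a') ->
  a' != [::] ->
  m (wlab (L x u a)) (c u a *: X) Y = c u (a ++ a') *: m (wlab (L x u a)) X Y.

Lemma klabels_cat u v : klabels (u ++ v) -> klabels u /\ klabels v.
Proof. by move=> uv; split=> y yu; apply: uv; rewrite mem_cat yu ?orbT. Qed.

Lemma word_single_scale (F : lmodType R) (f : {linear E' -> F}) u v :
  word_single f (L (s *: x) u v) = c u v *: word_single f (L x u v).
Proof.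
by rewrite /L; case: u v => [|z [|z' u]] [|t v] /=;
  rewrite ?scaler0 // cs linearZ.
Qed.

(** In each splitting the scaled letter lies in one factor and yields the multiplier of that factor.
    Attaching the other factor by [m] updates the multiplier, by [cl] if it stands on the left and
    by [cr] if it stands on the right. *)
Lemma word_hr_scale u v : klabels u -> klabels v ->
  hr (L (s *: x) u v) = c u v *: hr (L x u v) /\
  r (L (s *: x) u v) = c u v *: r (L x u v).
Proof.
have [n] := ubnP (size u + size v); elim: n u v => // n IH u v.
rewrite ltnS => sn ku kv.
suff rZ : r (L (s *: x) u v) = c u v *: r (L x u v).
  have hZ k z : (h : {additive E -> E}) (k *: z) = k *: h z.
    exact: linearZ_LR.
  by split=> //; rewrite /word_hr rZ hZ word_single_scale scalerDr.
have m0l k z : m k 0 z = 0 by apply: (morphD0 (mDl k z)).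
have m0r k z : m k z 0 = 0 by apply: (morphD0 (mDr k z)).
rewrite !(word_rE _ _ mDl mDr) !splits_mid scalerDr.
rewrite !(splits_morph _ _ (scalerDr (c u v))).
congr (_ + _); apply: eq_splits => a a' aa'.
  have [->|a0] := eqVneq a [::].
    by rewrite (word_hr_nil m i h) !m0l scaler0.
  have ka : klabels (a ++ a') by rewrite aa'.
  rewrite (IH _ _ _ (klabels_cat ka).2 kv).1 ?cl ?aa' //; apply: leq_trans sn.
  by rewrite -aa' size_cat -addnA -[ltnLHS]add0n ltn_add2r lt0n size_eq0.
(* [cr] requires a nonempty right factor, since [c] may treat the last letter differently; the
   excluded term is 0. *)
have [->|a0] := eqVneq a' [::].
  by rewrite (word_hr_nil m i h) !m0r scaler0.
have ka : klabels (a ++ a') by rewrite aa'.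
rewrite -/(L _ _ _) (IH _ _ _ ku (klabels_cat ka).1).1.
  have -> : wlab (L (s *: x) u a) = wlab (L x u a).
    by rewrite !wlab_cat !wlab_cons.
  by rewrite (cr _ _ ku ka a0) aa'.
apply: leq_trans sn.
by rewrite -aa' size_cat addnA -[ltnLHS]addn0 ltn_add2l lt0n size_eq0.
Qed.

Lemma word_theta_scale u v : klabels u -> klabels v ->
  theta (L (s *: x) u v) = c u v *: theta (L x u v).
Proof.
move=> ku kv; rewrite /word_theta word_single_scale (word_hr_scale ku kv).2.
have pZ k z : (p : {additive E -> E'}) (k *: z) = k *: p z.
  exact: linearZ_LR.
by rewrite pZ scalerDr.
Qed.

End Scale.
End WordLinearity.

(** * Polynomials in the lambdas *)

Section LpolyTheory.
Variable A : comNzRingType.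
Implicit Types (V W : lmodType A) (n : nat).

(** Most identities on V[Lambda] below are reduced to monomials in this way. *)
Lemma eq_lpoly V n (M : zmodType) (f g : lpoly V n -> M) :
  {morph f : x y / x + y} -> {morph g : x y / x + y} ->
  (forall m x, f (lmono m x) = g (lmono m x)) -> f =1 g.
Proof.
move=> fD gD fg u; rewrite [u]lpolyE.
rewrite (big_morph f fD (morphD0 fD)) (big_morph g gD (morphD0 gD)).
by apply: eq_bigr => m _; exact: fg.
Qed.

Lemma lmonoE V n m (x : V) :
  lmono m x = (<< m >> : {mpoly A[n]}) *: lcst n x :> lpoly V n.
Proof. by rewrite [RHS]lscaleUU mulm1 scale1r. Qed.

Lemma lcstD V n : {morph @lcst A V n : x y / x + y}.
Proof. exact: lmonoD. Qed.

Lemma lcst0 V n : lcst n (0 : V) = 0.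
Proof. exact: lmono0. Qed.

Lemma lcstZ V n a (x : V) : lcst n (a *: x) = a%:MP *: lcst n x.
Proof. by rewrite [RHS]lscaleUU mulm1. Qed.

Lemma eq_lext V W n (F F' : V -> lpoly W n) : F =1 F' -> lext F =1 lext F'.
Proof. by move=> e u; apply: eq_bigr => m _; rewrite e. Qed.

Lemma lextEw V W n (F : V -> lpoly W n) (d : {fset 'X_{1..n}}) (u : lpoly V n) :
  F 0 = 0 -> (msupp u `<=` d)%fset ->
  lext F u = \sum_(m <- d) (<< m >> : {mpoly A[n]}) *: F u@_m.
Proof.
move=> F0 le; apply: big_fset_incl => // m _ /mcoeff_outdom ->.
by rewrite F0 scaler0.
Qed.

Lemma lext_lmono V W n (F : V -> lpoly W n) m x :
  F 0 = 0 -> lext F (lmono m x) = (<< m >> : {mpoly A[n]}) *: F x.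
Proof.
move=> F0; rewrite (lextEw F0 (msupp_lmono _ _)) big_seq_fset1.
by rewrite mcoeff_lmono eqxx.
Qed.

Lemma lext_lcst V W n (F : V -> lpoly W n) x :
  F 0 = 0 -> lext F (lcst n x) = F x.
Proof. by move=> F0; rewrite lext_lmono // scale1r. Qed.

Lemma lextD V W n (F : V -> lpoly W n) : {morph F : x y / x + y} ->
  {morph lext F : u v / u + v}.
Proof.
move=> FD u v; have F0 := morphD0 FD.
rewrite !(@lextEw _ _ _ F (msupp u `|` msupp v)%fset) ?fsubsetUl ?fsubsetUr //.
  by rewrite -big_split; apply: eq_bigr => m _; rewrite mcoeffD FD scalerDr.
exact: msuppD_le.
Qed.

Lemma lextDf V W n (F G : V -> lpoly W n) u :
  lext (fun x => F x + G x) u = lext F u + lext G u.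
Proof. by rewrite -big_split; apply: eq_bigr => m _; rewrite scalerDr. Qed.

Lemma lextZf V W n (F : V -> lpoly W n) f u :
  lext (fun x => f *: F x) u = f *: lext F u.
Proof.
by rewrite [RHS]scaler_sumr; apply: eq_bigr => m _; rewrite !scalerA mulrC.
Qed.

Definition mon_eval n n' (mu : 'I_n -> {mpoly A[n']}) (m : 'X_{1..n}) :=
  \prod_(i < n) mu i ^+ m i.

Lemma mon_evalP n n' (mu : 'I_n -> {mpoly A[n']}) : mmorphism (mon_eval mu).
Proof.
split=> [m m'|]; last by rewrite /mon_eval big1 // => i _; rewrite cm1.
by rewrite /mon_eval -big_split; apply: eq_bigr => i _; rewrite cmM exprD.
Qed.

HB.instance Definition _ n n' (mu : 'I_n -> {mpoly A[n']}) :=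
  isMultiplicative.Build 'X_{1..n} {mpoly A[n']} (mon_eval mu) (mon_evalP mu).

Definition msubst n n' (mu : 'I_n -> {mpoly A[n']}) :
    {mpoly A[n]} -> {mpoly A[n']} :=
  mmap (@mkmalgU 'X_{1..n'} A mone) (mon_eval mu).

Lemma msubstU n n' (mu : 'I_n -> {mpoly A[n']}) c m :
  msubst mu << c *g m >> = c%:MP * mon_eval mu m.
Proof. exact: mmapU. Qed.

Lemma msubstD n n' (mu : 'I_n -> {mpoly A[n']}) : {morph msubst mu : f g / f +
  g}.
Proof. exact: mmapD. Qed.

Lemma msubstN n n' (mu : 'I_n -> {mpoly A[n']}) : {morph msubst mu : f / - f}.
Proof. exact: mmapN. Qed.

Lemma msubst_sum n n' (mu : 'I_n -> {mpoly A[n']}) I (s : seq I) (P : pred I)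
    (F : I -> {mpoly A[n]}) :
  msubst mu (\sum_(t <- s | P t) F t) = \sum_(t <- s | P t) msubst mu (F t).
Proof. exact: (big_morph _ (msubstD mu) (morphD0 (msubstD mu))). Qed.

Lemma msubst_lvar n n' (mu : 'I_n -> {mpoly A[n']}) (s : 'I_n) :
  msubst mu (lvar s) = mu s.
Proof.
rewrite /lvar valK msubstU mul1r /mon_eval (bigD1 s) //= cmUU expr1 big1 ?mulr1
  //.
by move=> t ts; rewrite cmU eq_sym (negPf ts) expr0.
Qed.

Lemma msubstC n n' (mu : 'I_n -> {mpoly A[n']}) c : msubst mu c%:MP = c%:MP.
Proof. by rewrite msubstU mmorph1 mulr1. Qed.

Lemma lsubstD V n n' (mu : 'I_n -> {mpoly A[n']}) :
  {morph @lsubst A V n n' mu : u v / u + v}.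
Proof.
have E (d : {fset 'X_{1..n}}) (u : lpoly V n) : (msupp u `<=` d)%fset ->
    lsubst mu u = \sum_(b <- d) mon_eval mu b *: lcst n' u@_b.
  move=> le; apply: big_fset_incl => // m _ /mcoeff_outdom ->.
  by rewrite lcst0 scaler0.
move=> u v.
rewrite !(E (msupp u `|` msupp v)%fset) ?fsubsetUl ?fsubsetUr ?msuppD_le //.
by rewrite -big_split; apply: eq_bigr => m _; rewrite mcoeffD lcstD scalerDr.
Qed.

Lemma lsubst_lmono V n n' (mu : 'I_n -> {mpoly A[n']}) m (x : V) :
  lsubst mu (lmono m x) = mon_eval mu m *: lcst n' x.
Proof.
have [->|x0] := eqVneq x 0;
  first by rewrite lmono0 lcst0 scaler0 /lsubst msupp0 big_seq_fset0.
rewrite /lsubst lmono.unlock msuppU (negPf x0) big_seq_fset1 mcoeffUU.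
by [].
Qed.

Lemma eq_lsubst V n n' (mu mu' : 'I_n -> {mpoly A[n']}) :
  mu =1 mu' -> @lsubst A V n n' mu =1 lsubst mu'.
Proof.
move=> e u; apply: eq_bigr => b _.
apply: (congr1 (fun f : {mpoly A[n']} => f *: lcst n' u@_b)).
by apply: eq_bigr => s _; rewrite e.
Qed.

Lemma lsubst_lcst V n n' (mu : 'I_n -> {mpoly A[n']}) (x : V) :
  lsubst mu (lcst n x) = lcst n' x.
Proof. by rewrite lsubst_lmono mmorph1 scale1r. Qed.

Lemma lsubstZ V n n' (mu : 'I_n -> {mpoly A[n']}) f (u : lpoly V n) :
  lsubst mu (f *: u) = msubst mu f *: lsubst mu u.
Proof.
apply: (@eq_lpoly V n _ (fun u => lsubst mu (f *: u))
                        (fun u => msubst mu f *: lsubst mu u)).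
- by move=> x y; rewrite scalerDr lsubstD.
- by move=> x y; rewrite lsubstD scalerDr.
move=> m x; rewrite [f]monalgE.
rewrite scaler_suml (big_morph _ (lsubstD mu) (morphD0 (lsubstD mu))).
rewrite (big_morph _ (msubstD mu) (morphD0 (msubstD mu))) scaler_suml.
apply: eq_bigr => b _; rewrite [_ *: lmono m x]lscaleUU !lsubst_lmono msubstU.
rewrite (mon_evalP mu).1 lcstZ.
move: (mon_eval mu b) (mon_eval mu m) (f@_b) => P Q c.
apply: etrans (scalerA _ _ _) _; apply: esym; apply: etrans (scalerA _ _ _) _.
apply: (congr1 (fun f : {mpoly A[n']} => f *: lcst n' x)).
move: (c%:MP) => k.
(* Proved in a generic ring: rewriting at type {mpoly _} unfolds products.    *)
have aux (R : comNzRingType) (a1 a2 a3 : R) : a1 * a2 * a3 = a2 * a3 * a1.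
  by rewrite -mulrA mulrC.
exact: (@aux _ k P Q).
Qed.

Lemma lsubst_comp V n n' n'' (mu : 'I_n -> {mpoly A[n']})
    (tau : 'I_n' -> {mpoly A[n'']}) (u : lpoly V n) :
  lsubst tau (lsubst mu u) = lsubst (fun s => msubst tau (mu s)) u.
Proof.
apply: (@eq_lpoly V n _ (fun u => lsubst tau (lsubst mu u))) => {u}.
- by move=> x y; rewrite !lsubstD.
- exact: lsubstD.
move=> m x; rewrite !lsubst_lmono lsubstZ lsubst_lcst; congr (_ *: _).
rewrite /mon_eval /msubst rmorph_prod; apply: eq_bigr => s _.
by rewrite rmorphXn.
Qed.

Lemma mulUU1 n (m m' : 'X_{1..n}) :
  << m >> * << m' >> = << mmul m m' >> :> {mpoly A[n]}.
Proof.
apply: etrans (fgmulUU _ _ _ _) _.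
exact: (congr1 (fun a : A => << a *g _ >>) (mul1r 1)).
Qed.

Lemma mon_eval_lvar n (m : 'X_{1..n}) :
  mon_eval (fun s : 'I_n => lvar s) m = << m >> :> {mpoly A[n]}.
Proof.
(* [e i k] is the monomial of the k-th power of the i-th variable. *)
pose e (i : 'I_n) k := iter k (mmul (@ucm 'I_n i)) mone.
have eE (i : 'I_n) k : lvar i ^+ k = << e i k >> :> {mpoly A[n]}.
  elim: k => [|k IH]; first by rewrite expr0.
  by rewrite exprS IH /lvar valK; exact: mulUU1.
have prodE (s : seq 'I_n) : \prod_(i <- s) lvar i ^+ m i
    = << \big[mmul/mone]_(i <- s) e i (m i) >> :> {mpoly A[n]}.
  elim: s => [|i s IH]; first by rewrite !big_nil.
  by rewrite !big_cons IH eE; exact: mulUU1.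
rewrite /mon_eval prodE; congr << _ >>; apply/eqP/cmP => j.
have bigE (s : seq 'I_n) : (\big[mmul/mone]_(i <- s) e i (m i)) j
    = (\sum_(i <- s) (i == j) * m i)%N.
  elim: s => [|i s IH]; first by rewrite !big_nil cm1.
  rewrite !big_cons cmM IH; congr (_ + _)%N.
  elim: (m i) => [|k IHk]; first by rewrite muln0 cm1.
  by rewrite cmM cmU IHk mulnS.
rewrite bigE (bigD1 j) //= eqxx mul1n big1 ?addn0 // => i /negPf->.
by rewrite mul0n.
Qed.

Lemma lsubst_id V n (u : lpoly V n) : lsubst (fun s : 'I_n => lvar s) u = u.
Proof.
apply: (@eq_lpoly V n _ _ id) => {u} //; first exact: lsubstD.
move=> m x; rewrite lsubst_lmono lmonoE.
exact: (congr1 (fun f : {mpoly A[n]} => f *: lcst n x) (mon_eval_lvar m)).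
Qed.

Lemma lmap_lmono V W n (F : {linear V -> W}) m x :
  lmap F (lmono m x : lpoly V n) = lmono m (F x).
Proof. by rewrite /lmap lext_lmono ?linear0 ?lcst0 // lmonoE. Qed.

Lemma lmapZ V W n (F : {linear V -> W}) f (u : lpoly V n) :
  lmap F (f *: u) = f *: lmap F u.
Proof.
have LD : {morph @lmap A V W n F : x y / x + y}.
  by apply: lextD => x y; rewrite linearD lcstD.
have F0 : lcst n (F 0) = 0 by rewrite linear0 lcst0.
apply: (@eq_lpoly V n _ (fun u => lmap F (f *: u))
                        (fun u => f *: lmap F u)) => {u}.
- by move=> x y; rewrite scalerDr LD.
- by move=> x y; rewrite LD scalerDr.
move=> m x; rewrite [f]monalgE !scaler_suml.
rewrite (big_morph _ LD (morphD0 LD)); apply: eq_bigr => b _.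
by rewrite lmap_lmono [_ *: lmono m x]lscaleUU lmap_lmono linearZ [RHS]lscaleUU.
Qed.

Lemma lmap_is_linear V W n (F : {linear V -> W}) :
  linear (@lmap A V W n F).
Proof.
move=> f u v; rewrite -lmapZ; apply: lextD => x y.
by rewrite linearD lcstD.
Qed.

HB.instance Definition _ V W n (F : {linear V -> W}) :=
  GRing.isLinear.Build {mpoly A[n]} (lpoly V n) (lpoly W n) *:%R
    (@lmap A V W n F) (@lmap_is_linear V W n F).

Lemma lmap_lcst V W n (F : {linear V -> W}) x :
  lmap F (lcst n x) = lcst n (F x).
Proof. by rewrite /lmap lext_lcst // linear0 lcst0. Qed.

Lemma lmap_comp V W (X : lmodType A) n (F : {linear W -> X}) (G : {linear V ->
  W}) (u : lpoly V n) :
  lmap F (lmap G u) = lmap (F \o G) u.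
Proof.
apply: (@eq_lpoly V n _ (fun u => lmap F (lmap G u)) (lmap (F \o G))) => {u}.
- by move=> x y; rewrite !raddfD.
- by move=> x y; rewrite !raddfD.
by move=> m x; rewrite !lmonoE !linearZ /= !lmap_lcst.
Qed.

Lemma lsubst_lmap V W n n' (mu : 'I_n -> {mpoly A[n']}) (F : {linear V -> W})
    (u : lpoly V n) :
  lsubst mu (lmap F u) = lmap F (lsubst mu u).
Proof.
apply: (@eq_lpoly V n _ (fun u => lsubst mu (lmap F u))
                        (fun u => lmap F (lsubst mu u))) => {u}.
- by move=> x y; rewrite raddfD lsubstD.
- by move=> x y; rewrite lsubstD raddfD.
by move=> m x; rewrite !lmonoE linearZ /= !lsubstZ linearZ /= lmap_lcst
  !lsubst_lcst
  lmap_lcst.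
Qed.

End LpolyTheory.

(** * Linearity over C and over polynomials in the lambdas *)

Section ClinearMaps.
Variable C : fieldType.
Local Notation A := {poly C}.
Implicit Types (V W : lmodType A) (n : nat).

Definition clinear V W n (F : V -> lpoly W n) :=
  forall c x y, F (c%:P *: x + y) = c%:P%:MP *: F x + F y.

(* [lext F] is not linear over polynomials involving d; [lscalar f] says that *)
(* it is over f, as is the case for f in C[lambda_1, ..., lambda_n].          *)
Definition lscalar n (f : {mpoly A[n]}) :=
  forall V W (F : V -> lpoly W n), clinear F ->
  forall u, lext F (f *: u) = f *: lext F u.

Lemma clinearD V W n (F : V -> lpoly W n) :
  clinear F -> {morph F : x y / x + y}.
Proof.
by move=> Fl x y; have := Fl 1 x y; rewrite polyC1 scale1r => ->;
  rewrite scale1r.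
Qed.

Lemma clinearZ V W n (F : V -> lpoly W n) c x :
  clinear F -> F (c%:P *: x) = c%:P%:MP *: F x.
Proof.
by move=> Fl; have := Fl c x 0; rewrite !addr0 (morphD0 (clinearD Fl)) addr0.
Qed.

Lemma clinear_lcst V W n (F : {linear V -> W}) : clinear (fun x =>
  lcst n (F x)).
Proof. by move=> c x y; rewrite linearP lcstD lcstZ. Qed.

Lemma clinear_lsubst V W n n' (mu : 'I_n -> {mpoly A[n']}) (F : V -> lpoly W n)
  :
  clinear F -> clinear (fun x => lsubst mu (F x)).
Proof. by move=> Fl c x y; rewrite Fl lsubstD lsubstZ msubstC. Qed.

(** Carries the sesquilinearity rules, where [a] is d and [f] the factor it turns into, from vectors
    to polynomials. *)
Lemma lext_scale V W n (F : V -> lpoly W n) (a : A) (f : {mpoly A[n]}) u :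
  {morph F : x y / x + y} -> (forall x, F (a *: x) = f *: F x) ->
  lext F (a%:MP *: u) = f *: lext F u.
Proof.
move=> FD Fa; have F0 := morphD0 FD.
apply: (@eq_lpoly _ V n _ (fun u => lext F (a%:MP *: u))
                          (fun u => f *: lext F u)) => {u}.
- by move=> x y; rewrite scalerDr lextD.
- by move=> x y; rewrite lextD // scalerDr.
move=> m x; rewrite [_ *: lmono m x]lscaleUU mul1m !lext_lmono // Fa.
apply: etrans (scalerA _ _ _) _; apply: esym; apply: etrans (scalerA _ _ _) _.
by apply: (congr1 (fun g : {mpoly A[n]} => g *: F x));
  exact: (@mulrC {mpoly A[n]}).
Qed.

Lemma lscalarU n m : lscalar (<< m >> : {mpoly A[n]}).
Proof.
move=> V W F Fl u; have FD := clinearD Fl; have F0 := morphD0 FD.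
apply: (@eq_lpoly _ V n _ (fun u => lext F (<< m >> *: u))
                          (fun u => << m >> *: lext F u)) => {u}.
- by move=> x y; rewrite scalerDr lextD.
- by move=> x y; rewrite lextD // scalerDr.
move=> b x; rewrite [_ *: lmono b x]lscaleUU scale1r !lext_lmono //.
apply: esym; apply: etrans (scalerA _ _ _) _.
exact: (congr1 (fun g : {mpoly A[n]} => g *: F x) (mulUU1 _ _ _)).
Qed.

Lemma lscalarC n c : lscalar (c%:P%:MP : {mpoly A[n]}).
Proof.
by move=> V W F Fl u; apply: lext_scale (clinearD Fl) _ => x; exact: clinearZ.
Qed.

Lemma lscalar0 n : lscalar (0 : {mpoly A[n]}).
Proof.
by move=> V W F Fl u; rewrite !scale0r (morphD0 (lextD (clinearD Fl))).
Qed.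

Lemma lscalarD n (f g : {mpoly A[n]}) : lscalar f -> lscalar g -> lscalar (f +
  g).
Proof.
move=> fs gs V W F Fl u; rewrite !scalerDl (lextD (clinearD Fl)).
by rewrite fs // gs.
Qed.

Lemma lscalarN n (f : {mpoly A[n]}) : lscalar f -> lscalar (- f).
Proof.
move=> fs V W F Fl u; have LD := lextD (clinearD Fl).
rewrite !scaleNr -fs //; apply: (addrI (lext F (f *: u))).
by rewrite -LD !subrr (morphD0 LD).
Qed.

Lemma lscalar1 n : lscalar (1 : {mpoly A[n]}).
Proof. exact: lscalarU. Qed.

Lemma lscalarM n (f g : {mpoly A[n]}) : lscalar f -> lscalar g -> lscalar (f *
  g).
Proof.
by move=> fs gs V W F Fl u; rewrite -!scalerA fs // gs.
Qed.

Lemma lscalar_lvar n s : lscalar (lvar s : {mpoly A[n]}).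
Proof.
by rewrite /lvar; case: insubP => [o _ _|_];
  [exact: lscalarU | exact: lscalar0].
Qed.

Lemma lscalar_sum n I (s : seq I) (P : pred I) (F : I -> {mpoly A[n]}) :
  (forall t, lscalar (F t)) -> lscalar (\sum_(t <- s | P t) F t).
Proof.
move=> Fs; apply: (big_ind (@lscalar n)) => [||t _]; last exact: Fs.
  exact: lscalar0.
exact: lscalarD.
Qed.

Lemma lscalar_mon_eval n n' (mu : 'I_n -> {mpoly A[n']}) m :
  (forall s, lscalar (mu s)) -> lscalar (mon_eval mu m).
Proof.
move=> mus; apply: (big_ind (@lscalar n')) => [||t _].
- exact: lscalar1.
- exact: lscalarM.
elim: (m t) => [|k IH]; first by rewrite expr0; exact: lscalar1.
by rewrite exprS; apply: lscalarM.
Qed.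

(** The monomials of [u] become products of the [mu s], which can be pulled out of [lext] because
    each of them is [lscalar]. *)
Lemma lsubst_lext V W n n' (mu : 'I_n -> {mpoly A[n']}) (F : V -> lpoly W n)
    (u : lpoly V n) :
  (forall s, lscalar (mu s)) -> clinear F ->
  lsubst mu (lext F u) = lext (fun x => lsubst mu (F x)) (lsubst mu u).
Proof.
move=> mus Fl; have FD := clinearD Fl; have F0 := morphD0 FD.
have SF := clinear_lsubst mu Fl; have SD := clinearD SF; have S0 := morphD0 SD.
apply: (@eq_lpoly _ V n _ (fun u => lsubst mu (lext F u))
          (fun u => lext (fun x => lsubst mu (F x)) (lsubst mu u))) => {u}.
- by move=> x y; rewrite lextD // lsubstD.
- by move=> x y; rewrite lsubstD lextD.
move=> m x; rewrite lext_lmono // lsubstZ lsubst_lmono.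
rewrite (lscalar_mon_eval m mus) // lext_lcst //.
apply: (congr1 (fun g : {mpoly A[n']} => g *: lsubst mu (F x))).
rewrite msubstU; move: (mon_eval mu m) => f.
exact: (@mul1r {mpoly A[n']}).
Qed.

End ClinearMaps.

(** * The grading of V[Lambda], with the lambdas in degree 0 *)

Section GradedPolynomials.
Variable C : fieldType.
Local Notation A := {poly C}.
Implicit Types (V W : gradedModule C) (n : nat) (d : int).

Definition lgr V n d (u : lpoly V n) := forall m, gr d u@_m.

Lemma grD V d (x y : V) : gr d x -> gr d y -> gr d (x + y).
Proof. by move=> gx gy; rewrite -[x]scale1r; exact: grP. Qed.

Lemma grZ V d a (x : V) : gr d x -> gr d (a *: x).
Proof. by move=> gx; rewrite -[_ *: _]addr0; apply: grP => //; exact: gr0. Qed.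

Lemma lgr0 V n d : lgr d (0 : lpoly V n).
Proof. by move=> m; rewrite mcoeff0; exact: gr0. Qed.

Lemma lgrD V n d (u v : lpoly V n) : lgr d u -> lgr d v -> lgr d (u + v).
Proof. by move=> gu gv m; rewrite mcoeffD; apply: grD;
  [exact: gu|exact: gv]. Qed.

Lemma lgr_sum V n d I (s : seq I) (P : pred I) (F : I -> lpoly V n) :
  (forall t, lgr d (F t)) -> lgr d (\sum_(t <- s | P t) F t).
Proof.
move=> Fs; apply: (big_ind (@lgr V n d)) => [||t _]; last exact: Fs.
  exact: lgr0.
exact: lgrD.
Qed.

Lemma lgr_lmono V n d m (x : V) : gr d x -> lgr d (lmono m x : lpoly V n).
Proof.
move=> gx m'; rewrite mcoeff_lmono; case: eqP => _ //; exact: gr0.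
Qed.

Lemma lgrZ V n d (f : {mpoly A[n]}) (u : lpoly V n) : lgr d u -> lgr d (f *: u).
Proof.
move=> gu; have -> : f *: u = lscale f u by [].
rewrite lscale.unlock.
by apply: lgr_sum => a; apply: lgr_sum => b; apply: lgr_lmono; apply: grZ;
  exact: gu.
Qed.

Lemma lgr_lext V W n d e (F : V -> lpoly W n) u :
  (forall x, gr d x -> lgr e (F x)) -> lgr d u -> lgr e (lext F u).
Proof. by move=> Fg gu; apply: lgr_sum => m; apply: lgrZ; apply: Fg;
  exact: gu. Qed.

Lemma lgr_lsubst V n n' (mu : 'I_n -> {mpoly A[n']}) d (u : lpoly V n) :
  lgr d u -> lgr d (lsubst mu u).
Proof.
by move=> gu; apply: lgr_sum => m; apply: lgrZ; apply: lgr_lmono; exact: gu.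
Qed.

Lemma lgr_lmap V W n d e (F : V -> W) (u : lpoly V n) :
  homogeneous e F -> lgr d u -> lgr (d + e) (lmap F u).
Proof. by move=> Fg; apply: lgr_lext => x gx; apply: lgr_lmono; exact: Fg. Qed.

(** Reduces identities whose signs depend on degrees to homogeneous vectors. *)
Lemma lgr_ind V n d (P : lpoly V n -> Prop) :
  (forall u v, P u -> P v -> P (u + v)) ->
  P 0 ->
  (forall m x, gr d x -> P ((<< m >> : {mpoly A[n]}) *: lcst n x)) ->
  forall u, lgr d u -> P u.
Proof.
move=> PD P0 Pm u gu; rewrite [u]lpolyE.
apply: (big_ind P) => // m _; rewrite lmonoE; exact: Pm.
Qed.

End GradedPolynomials.

(** * The binary bracket *)

Section Bracket.
Variables (C : fieldType) (V : gradedModule C) (rho2 : lmaps V 2).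
Local Notation A := {poly C}.

(** The extension of [(rho_2)_mu] to V[Lambda], which serves as [m] in the abstract transfer. *)
Definition lbracket n (mu : {mpoly A[n]}) (x y : lpoly V n) : lpoly V n :=
  lext (fun a => lext (fun b =>
    lsubst (fun _ : 'I_1 => mu) (rho2 [tuple a; b])) y) x.

Lemma tupd2l (T : Type) (a b c : T) : tupd [tuple a; b] ord0 c = [tuple c; b].
Proof.
by apply: eq_from_tnth => j; rewrite tnth_mktuple; case: j => [[|[|j]] jl].
Qed.

Lemma tupd2r (T : Type) (a b c : T) :
  tupd [tuple a; b] ord_max c = [tuple a; c].
Proof.
by apply: eq_from_tnth => j; rewrite tnth_mktuple; case: j => [[|[|j]] jl].
Qed.

Hypothesis cs : conformal_sesquilinear rho2.

Lemma rho2l b : clinear (fun a => rho2 [tuple a; b]).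
Proof.
by move=> c x y; have := cs_multilinear cs [tuple 0; b] ord0 c x y;
  rewrite !tupd2l.
Qed.

Lemma rho2r a : clinear (fun b => rho2 [tuple a; b]).
Proof.
by move=> c x y; have := cs_multilinear cs [tuple a; 0] ord_max c x y;
  rewrite !tupd2r.
Qed.

Lemma rho2_dl a b : rho2 [tuple 'X *: a; b] = - lvar 0 *: rho2 [tuple a; b].
Proof.
by have := cs_nonlast cs [tuple a; b] (j := ord0) isT; rewrite tupd2l.
Qed.

Lemma rho2_dr a b :
  rho2 [tuple a; 'X *: b] = ('X%:MP + lvar 0) *: rho2 [tuple a; b].
Proof.
by have := cs_last cs [tuple a; b] (j := ord_max) erefl;
  rewrite tupd2r big_nat1.
Qed.

Section Fixed.
Variable n : nat.
Implicit Types (mu f : {mpoly A[n]}) (x y : lpoly V n).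

Local Notation br mu a b := (lsubst (fun _ : 'I_1 => mu) (rho2 [tuple a; b])).

Lemma clinear_brr mu a : clinear (fun b => br mu a b).
Proof. exact: clinear_lsubst (rho2r a). Qed.

Lemma clinear_brl mu b : clinear (fun a => br mu a b).
Proof. exact: clinear_lsubst (rho2l b). Qed.

Lemma clinear_bracket mu y : clinear (fun a => lext (fun b => br mu a b) y).
Proof.
move=> c x x'; rewrite -lextZf -lextDf; apply: eq_lext => b.
exact: (clinear_brl mu b).
Qed.

Lemma lbracketDl mu y : {morph (lbracket mu)^~ y : x x' / x + x'}.
Proof. exact: lextD (clinearD (clinear_bracket mu y)). Qed.

Lemma lbracketDr mu x : {morph lbracket mu x : y y' / y + y'}.
Proof.
move=> y y'; rewrite -lextDf; apply: eq_lext => a.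
exact: lextD (clinearD (clinear_brr mu a)) _ _.
Qed.

Lemma lbracketZl mu f x y : lscalar f ->
  lbracket mu (f *: x) y = f *: lbracket mu x y.
Proof. by move=> fs; apply: fs; exact: clinear_bracket. Qed.

Lemma lbracketZr mu f x y : lscalar f ->
  lbracket mu x (f *: y) = f *: lbracket mu x y.
Proof.
move=> fs; rewrite -lextZf; apply: eq_lext => a.
by apply: fs; exact: clinear_brr.
Qed.

Lemma lbracket_lcst mu a b : lbracket mu (lcst n a) (lcst n b) = br mu a b.
Proof.
rewrite /lbracket lext_lcst;
  last exact: morphD0 (clinearD (clinear_bracket _ _)).
by rewrite lext_lcst //; exact: morphD0 (clinearD (clinear_brr _ _)).
Qed.

Lemma lbracket_lcstr mu x b :
  lbracket mu x (lcst n b) = lext (fun a => br mu a b) x.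
Proof.
by apply: eq_lext => a; rewrite lext_lcst //;
  exact: morphD0 (clinearD (clinear_brr _ _)).
Qed.

Lemma lbracket_lcstl mu a y :
  lbracket mu (lcst n a) y = lext (fun b => br mu a b) y.
Proof.
by rewrite /lbracket lext_lcst //;
  exact: morphD0 (clinearD (clinear_bracket _ _)).
Qed.

Lemma lbracket_dl mu x y :
  lbracket mu ('X%:MP *: x) y = - mu *: lbracket mu x y.
Proof.
apply: lext_scale; first exact: clinearD (clinear_bracket mu y).
move=> a; rewrite -lextZf; apply: eq_lext => b.
rewrite rho2_dl lsubstZ msubstN.
exact: (congr1 (fun g : {mpoly A[n]} => - g *: br mu a b) (msubst_lvar _ ord0)).
Qed.

Lemma lbracket_dr mu x y :
  lbracket mu x ('X%:MP *: y) = ('X%:MP + mu) *: lbracket mu x y.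
Proof.
rewrite -[RHS]lextZf; apply: eq_lext => a.
apply: lext_scale; first exact: clinearD (clinear_brr mu a).
move=> b; rewrite rho2_dr lsubstZ msubstD msubstC.
exact: (congr1 (fun g : {mpoly A[n]} => ('X%:MP + g) *: br mu a b)
  (msubst_lvar _ ord0)).
Qed.

Lemma lgr_lbracket mu d e x y : lmaps_homogeneous (- 1) rho2 ->
  lgr d x -> lgr e y -> lgr (d + e - 1) (lbracket mu x y).
Proof.
move=> h2 gx gy; apply: lgr_lext gx => a ga; apply: lgr_lext gy => b gb.
apply: lgr_lsubst => m.
have := h2 (fun j => if j == ord0 then d else e) [tuple a; b].
rewrite big_ord_recl big_ord1 /=; apply.
by case=> [[|[|j]] jl].
Qed.

End Fixed.
End Bracket.

(** * Indexing and substitution in the A_infty-relation *)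

Lemma insertion_reindex (M : zmodType) n (F : nat -> nat -> nat -> M) :
  \sum_(1 <= k < n.+1) \sum_(1 <= l < n.+1 | (k + l == n.+1)%N)
    \sum_(j < k) F k l j
  = \sum_(0 <= j < n) \sum_(0 <= l < n - j) F (n - l)%N l.+1 j.
Proof.
transitivity (\sum_(1 <= k < n.+1) \sum_(0 <= j < n | (j < k)%N)
  F k (n.+1 - k)%N j).
  (* The equation [k + l = n + 1] leaves a single [l]. *)
  apply: eq_big_nat => k kn; rewrite (eq_bigl (pred1 (n.+1 - k)%N)); last first.
    by move=> l /=; apply/eqP/eqP; lia.
  rewrite big_nat1_eq; case: ifP => [_|]; last by lia.
  rewrite -(big_mkord xpredT (F k (n.+1 - k)%N)) (@big_nat_widen _ _ _ 0 k n)
    //; lia.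
under eq_bigr => k _ do rewrite big_mkcond.
rewrite exchange_big /=; apply: eq_big_nat => j jn.
rewrite big_nat_rev big_add1 -big_mkcond /=.
rewrite (@big_nat_widen _ _ _ 0 (n - j) n) ?leq_subr // big_nat_cond
  [RHS]big_nat_cond.
apply: eq_big => [l|l /andP[/andP[_ ln] _]]; first by apply/idP/idP; lia.
by congr F; lia.
Qed.

Lemma insertion_sum2 (M : zmodType) (F : nat -> nat -> nat -> M) :
  \sum_(1 <= k < 3) \sum_(1 <= l < 3 | (k + l == 3)%N) \sum_(j < k) F k l j
  = F 2%N 1%N 0%N + F 1%N 2%N 0%N + F 2%N 1%N 1%N.
Proof.
rewrite insertion_reindex.
by rewrite big_nat_recr //= big_nat1 big_nat_recr //= !big_nat1.
Qed.

Lemma insertion_sum3 (M : zmodType) (F : nat -> nat -> nat -> M) :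
  \sum_(1 <= k < 4) \sum_(1 <= l < 4 | (k + l == 4)%N) \sum_(j < k) F k l j
  = F 3%N 1%N 0%N + F 2%N 2%N 0%N + F 1%N 3%N 0%N
    + (F 3%N 1%N 1%N + F 2%N 2%N 1%N) + F 3%N 1%N 2%N.
Proof.
rewrite insertion_reindex.
rewrite big_nat_recr //= big_nat_recr //= big_nat1.
rewrite big_nat_recr //= big_nat_recr //= big_nat1.
by rewrite big_nat_recr //= !big_nat1.
Qed.

Section Insertion.
Variable C : fieldType.
Local Notation A := {poly C}.

Definition ins_tuple (T : zmodType) k l n j (v : n.-tuple T) (x : T) :
    k.-tuple T :=
  [tuple if (i < j)%N then v`_i else if i == j :> nat then x
         else v`_(i + l.-1) | i < k].

(* The substitution of [insertion], with tau_s in place of lambda_(s+1).      *)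
Definition ins_labels n j l (tau : nat -> {mpoly A[n]}) (s : nat) :=
  if (s < j)%N then tau s
  else if s == j then \sum_(j <= t < j + l) tau t
  else tau (s + l.-1)%N.

Lemma msubst_lvar_lt n n' (tau : nat -> {mpoly A[n']}) s :
  (s < n)%N -> msubst (fun s : 'I_n => tau s) (lvar s) = tau s.
Proof.
by move=> sn; have := msubst_lvar (fun s : 'I_n => tau s) (Ordinal sn).
Qed.

(** Under substitution, the lambda of the inserted argument receives the sum of the labels of the
    replaced subword, as in [contract]. *)
Lemma lsubst_insertion (V : lmodType A) k l n n' j (phi : lmaps V k)
    (psi : lmaps V l) (v : n.-tuple V) (tau : nat -> {mpoly A[n']}) :
  (0 < l)%N -> (k + l = n.+1)%N -> (j < k)%N ->
  (forall s, lscalar (tau s)) ->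
  clinear (fun x => phi (ins_tuple k l j v x)) ->
  lsubst (fun s : 'I_n.-1 => tau s) (insertion phi psi j v) =
  lext (fun x => lsubst (fun s : 'I_k.-1 => ins_labels j l tau s)
                        (phi (ins_tuple k l j v x)))
       (lsubst (fun s : 'I_l.-1 => tau (j + s)%N)
               (psi [tuple v`_(j + i) | i < l])).
Proof.
move=> l0 kl jk taus phil.
rewrite /insertion lsubst_lext //; last exact: clinear_lsubst phil.
rewrite lsubst_comp.
rewrite (eq_lsubst (mu' := fun s : 'I_l.-1 => tau (j + s)%N)); last first.
  by move=> s /=; rewrite msubst_lvar_lt //; have := ltn_ord s; lia.
apply: eq_lext => x; rewrite lsubst_comp; apply: eq_lsubst => s.
have sk := ltn_ord s; rewrite /ins_labels.
case: ltngtP => sj; last 1 first.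
- rewrite msubst_sum !big_seq; apply: eq_bigr => t.
  by rewrite mem_index_iota => tj; apply: msubst_lvar_lt; lia.
- by apply: msubst_lvar_lt; lia.
by apply: msubst_lvar_lt; lia.
Qed.

End Insertion.

Lemma insertion_0l (A : comNzRingType) (V : lmodType A) k l j n
    (phi : lmaps V k) (v : n.-tuple V) :
  insertion phi (fun _ : l.-tuple V => 0) j v = 0.
Proof.
by rewrite /insertion /lsubst msupp0 big_seq_fset0 /lext msupp0 big_seq_fset0.
Qed.

Lemma insertion_0r (A : comNzRingType) (V : lmodType A) k l j n
    (psi : lmaps V l) (v : n.-tuple V) :
  insertion (fun _ : k.-tuple V => 0) psi j v = 0.
Proof.
rewrite /insertion /lext big1 // => m _.
by rewrite /lsubst msupp0 big_seq_fset0 scaler0.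
Qed.

Lemma ksignE (R : nzRingType) (E : lmodType R) (d : int) (x : E) :
  (-1) ^+ `|d|%N *: x = ksign d x.
Proof. by rewrite -signr_odd scaler_sign. Qed.

Lemma mktuple1_0 (T : zmodType) (f : 'I_1 -> T) :
  [tuple f t | t < 1]`_0 = f ord0.
Proof. by rewrite /= enum_ordSl. Qed.

Lemma addr_sum3 (M : zmodType) (a a' b b' c c' : M) :
  (a + a') + (b + b') + (c + c') = (a + b + c) + (a' + b' + c').
Proof. by rewrite (addrACA a) (addrACA (a + b)). Qed.

(** * Leibniz rule and associativity of the bracket *)

Section BracketRelations.
Variables (C : fieldType) (V : gradedModule C).
Local Notation A := {poly C}.
Variables (rho1 : {linear V -> V}) (rho2 : lmaps V 2).
Hypothesis AV : Ainfty1_conformal (two_maps rho1 rho2).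

Let cs : conformal_sesquilinear rho2 := ai_sesquilinear AV (k := 2) isT.

Lemma ins_tuple20 l n (v : n.-tuple V) x :
  ins_tuple 2 l 0 v x = [tuple x; v`_l.-1.+1].
Proof.
by apply: eq_from_tnth => j; rewrite tnth_mktuple; case: j => [[|[|j]] jl] //=.
Qed.

Lemma ins_tuple21 l n (v : n.-tuple V) x :
  ins_tuple 2 l 1 v x = [tuple v`_0; x].
Proof.
by apply: eq_from_tnth => j; rewrite tnth_mktuple; case: j => [[|[|j]] jl] //=.
Qed.

Lemma ins20_bracket n l k (v : k.-tuple V) (L : nat -> {mpoly A[n]}) u :
  lext (fun x => lsubst (fun s : 'I_1 => L s) (rho2 (ins_tuple 2 l 0 v x))) u
  = lbracket rho2 (L 0%N) u (lcst n v`_l.-1.+1).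
Proof.
rewrite (lbracket_lcstr cs); apply: eq_lext => x; rewrite ins_tuple20.
by apply: eq_lsubst => s; rewrite ord1.
Qed.

Lemma ins21_bracket n l k (v : k.-tuple V) (L : nat -> {mpoly A[n]}) u :
  lext (fun x => lsubst (fun s : 'I_1 => L s) (rho2 (ins_tuple 2 l 1 v x))) u
  = lbracket rho2 (L 0%N) (lcst n v`_0) u.
Proof.
rewrite (lbracket_lcstl cs); apply: eq_lext => x; rewrite ins_tuple21.
by apply: eq_lsubst => s; rewrite ord1.
Qed.

Lemma ins_two_maps_clinear l j k (v : k.-tuple V) : (j < 2)%N ->
  clinear (fun x => two_maps rho1 rho2 (ins_tuple 2 l j v x)).
Proof.
case: j => [|[|]] // _ c x y.
  by rewrite !ins_tuple20; exact: (rho2l cs).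
by rewrite !ins_tuple21; exact: (rho2r cs).
Qed.

Lemma tuple20 (T : zmodType) k (v : k.-tuple T) j :
  [tuple v`_(j + i) | i < 2] = [tuple v`_j; v`_j.+1].
Proof.
by apply: eq_from_tnth => s; rewrite tnth_mktuple; case: s => [[|[|s]] sl] //=;
  rewrite ?addn0 ?addn1.
Qed.

Section Fixed.
Variable n : nat.
Implicit Types (mu nu : {mpoly A[n]}) (x y z : lpoly V n).

(** The relation with two arguments, after specialising lambda_1 to [mu]. *)
Lemma bracket_differential_lcst mu d e (a b : V) : lscalar mu ->
  gr d a -> gr e b ->
  lmap rho1 (lbracket rho2 mu (lcst n a) (lcst n b))
  + lbracket rho2 mu (lmap rho1 (lcst n a)) (lcst n b)
  + ksign d (lbracket rho2 mu (lcst n a) (lmap rho1 (lcst n b))) = 0.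
Proof.
move=> mus ga gb; pose tau (_ : nat) := mu.
pose dd (j : 'I_2) := if j == ord0 then d else e.
have gv j : gr (dd j) (tnth [tuple a; b] j) by case: j => [[|[|j]] jl].
have := ai_relation AV (n := 2) isT gv.
rewrite (insertion_sum2 (fun k l j =>
  (-1) ^+ `|(\sum_(i < 2 | (i < j)%N) dd i)%R|%N
  *: insertion (two_maps rho1 rho2 (k := k)) (two_maps rho1 rho2 (k := l)) j
       [tuple a; b])).
have s0 : \sum_(i < 2 | (i < 0)%N) dd i = 0 by rewrite big1.
have s1 : \sum_(i < 2 | (i < 1)%N) dd i = d.
  by rewrite big_mkcond big_ord_recl big_ord1 /= addr0.
rewrite !ksignE s0 s1 !ksign0l => /(congr1 (lsubst (fun s : 'I_2.-1 => tau s))).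
rewrite !lsubstD (morph_ksign _ (lsubstD _)) (morphD0 (lsubstD _)).
have cl1 : clinear (fun x : V =>
  two_maps rho1 rho2 (ins_tuple 1 2 0 [tuple a; b] x)).
  by move=> c x y; rewrite /two_maps !mktuple1_0; exact: clinear_lcst.
rewrite !lsubst_insertion //; [|exact: ins_two_maps_clinear..].
rewrite /two_maps !mktuple1_0 !lsubst_lcst ins20_bracket ins21_bracket /=.
rewrite tuple20 /ins_labels /= big_nat1 -!lmap_lcst [X in X + ksign _ _]addrC.
rewrite (lbracket_lcst cs) => <-;
  apply: (congr1 (fun z : lpoly V n => z + _ + _)).
by apply: eq_lext => x; rewrite mktuple1_0 /= lsubst_lcst.
Qed.

(** The relation with three arguments, after specialising the lambdas to [mu] and [nu]; the terms
    containing the vanishing map of arity 3 drop out. *)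
Lemma bracket_assoc_lcst mu nu d e f (a b c : V) : lscalar mu -> lscalar nu ->
  gr d a -> gr e b -> gr f c ->
  lbracket rho2 (mu + nu) (lbracket rho2 mu (lcst n a) (lcst n b)) (lcst n c)
  + ksign d (lbracket rho2 mu (lcst n a)
               (lbracket rho2 nu (lcst n b) (lcst n c))) = 0.
Proof.
move=> mus nus ga gb gc; pose tau (s : nat) := if s == 0%N then mu else nu.
have taus s : lscalar (tau s) by rewrite /tau; case: eqP.
pose dd (j : 'I_3) :=
  if j == 0 :> nat then d else if j == 1 :> nat then e else f.
have gv j : gr (dd j) (tnth [tuple a; b; c] j) by case: j => [[|[|[|j]]] jl].
have := ai_relation AV (n := 3) isT gv.
rewrite (insertion_sum3 (fun k l j =>
  (-1) ^+ `|(\sum_(i < 3 | (i < j)%N) dd i)%R|%N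
  *: insertion (two_maps rho1 rho2 (k := k)) (two_maps rho1 rho2 (k := l)) j
       [tuple a; b; c])).
have two3 : two_maps rho1 rho2 (k := 3%N) = fun _ => 0 by [].
rewrite two3.
rewrite !insertion_0l !insertion_0r !scaler0 !addr0 !add0r.
have s0 : \sum_(i < 3 | (i < 0)%N) dd i = 0 by rewrite big1.
have s1 : \sum_(i < 3 | (i < 1)%N) dd i = d.
  by rewrite big_mkcond !big_ord_recl big_ord0 /= !addr0.
rewrite !ksignE s0 s1 !ksign0l => /(congr1 (lsubst (fun s : 'I_3.-1 => tau s))).
rewrite !lsubstD (morph_ksign _ (lsubstD _)) (morphD0 (lsubstD _)).
rewrite !lsubst_insertion //; [|exact: ins_two_maps_clinear..].
rewrite /two_maps ins20_bracket ins21_bracket !tuple20 /=.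
rewrite /ins_labels /= big_nat_recr //= big_nat1 !(lbracket_lcst cs) => <-.
have e1 u : lsubst (fun s : 'I_1 => tau (0 + s)%N) u = lsubst (fun=> mu) u.
  by apply: eq_lsubst => s; rewrite ord1.
have e2 u : lsubst (fun s : 'I_1 => tau (1 + s)%N) u = lsubst (fun=> nu) u.
  by apply: eq_lsubst => s; rewrite ord1.
by rewrite e1 e2.
Qed.

(** The left-hand side is additive in [x] and [y] and monomials can be pulled out of it, so
    constants suffice. *)
Lemma bracket_differential mu d e x y : lscalar mu -> lgr d x -> lgr e y ->
  lmap rho1 (lbracket rho2 mu x y) + lbracket rho2 mu (lmap rho1 x) y
  + ksign d (lbracket rho2 mu x (lmap rho1 y)) = 0.
Proof.
move=> mus gx gy; pose P u v := lmap rho1 (lbracket rho2 mu u v)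
  + lbracket rho2 mu (lmap rho1 u) v
  + ksign d (lbracket rho2 mu u (lmap rho1 v)).
have PDl v : {morph P^~ v : u u' / u + u'}.
  move=> u u'; rewrite /P [lmap rho1 (u + u')]raddfD !(lbracketDl cs).
  rewrite raddfD ksignDr.
  exact: addr_sum3.
have PDr u : {morph P u : v v' / v + v'}.
  move=> v v'; rewrite /P [lmap rho1 (v + v')]raddfD !(lbracketDr cs).
  rewrite raddfD ksignDr.
  exact: addr_sum3.
have ms m : lscalar (<< m >> : {mpoly A[n]}) by exact: lscalarU.
have lZ m u : lmap rho1 ((<< m >> : {mpoly A[n]}) *: u)
    = (<< m >> : {mpoly A[n]}) *: lmap rho1 u by rewrite linearZ.
have PZl m u v : P ((<< m >> : {mpoly A[n]}) *: u) v =
  (<< m >> : {mpoly A[n]}) *: P u v.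
  rewrite /P lZ !(lbracketZl cs _ _ _ (ms m)) lZ.
  by rewrite -(morph_ksign _ (scalerDr _)) -!scalerDr.
have PZr m u v : P u ((<< m >> : {mpoly A[n]}) *: v) =
  (<< m >> : {mpoly A[n]}) *: P u v.
  rewrite /P lZ !(lbracketZr cs _ _ _ (ms m)) lZ.
  by rewrite -(morph_ksign _ (scalerDr _)) -!scalerDr.
have P0l := morphD0 (PDl _); have P0r := morphD0 (PDr _).
change (P x y = 0).
apply: (lgr_ind (P := fun u => P u y = 0) _ _ _ gx) => [u u' Pu Pu'||m a ga].
- by rewrite PDl Pu Pu' addr0.
- exact: P0l.
rewrite PZl (_ : P _ _ = 0) ?scaler0 //.
apply: (lgr_ind (P := fun v => P (lcst n a) v = 0) _ _ _ gy) =>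
  [u u' Pu Pu'||m' b gb].
- by rewrite PDr Pu Pu' addr0.
- exact: P0r.
by rewrite PZr /P (bracket_differential_lcst mus ga gb) scaler0.
Qed.

Lemma bracket_assoc mu nu d e f x y z : lscalar mu -> lscalar nu ->
  lgr d x -> lgr e y -> lgr f z ->
  lbracket rho2 (mu + nu) (lbracket rho2 mu x y) z
  + ksign d (lbracket rho2 mu x (lbracket rho2 nu y z)) = 0.
Proof.
move=> mus nus gx gy gz; pose P u v w :=
  lbracket rho2 (mu + nu) (lbracket rho2 mu u v) w
  + ksign d (lbracket rho2 mu u (lbracket rho2 nu v w)).
have P1 v w : {morph (fun u => P u v w) : u u' / u + u'}.
  by move=> u u'; rewrite /P !(lbracketDl cs) ksignDr addrACA.
have P2 u w : {morph (fun v => P u v w) : v v' / v + v'}.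
  by move=> v v'; rewrite /P (lbracketDr cs) !(lbracketDl cs) (lbracketDr cs)
    ksignDr addrACA.
have P3 u v : {morph P u v : w w' / w + w'}.
  by move=> w w'; rewrite /P !(lbracketDr cs) ksignDr addrACA.
have ms m : lscalar (<< m >> : {mpoly A[n]}) by exact: lscalarU.
have ksignZ m u : ksign d ((<< m >> : {mpoly A[n]}) *: u) =
  (<< m >> : {mpoly A[n]}) *: ksign d u.
  by rewrite (morph_ksign _ (scalerDr _)).
have PZ1 m u v w : P ((<< m >> : {mpoly A[n]}) *: u) v w =
  (<< m >> : {mpoly A[n]}) *: P u v w.
  by rewrite /P !(lbracketZl cs _ _ _ (ms m)) ksignZ -scalerDr.
have PZ2 m u v w : P u ((<< m >> : {mpoly A[n]}) *: v) w =
  (<< m >> : {mpoly A[n]}) *: P u v w.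
  rewrite /P (lbracketZr cs _ _ _ (ms m)) !(lbracketZl cs _ _ _ (ms m)).
  by rewrite (lbracketZr cs _ _ _ (ms m)) ksignZ -scalerDr.
have PZ3 m u v w : P u v ((<< m >> : {mpoly A[n]}) *: w) =
  (<< m >> : {mpoly A[n]}) *: P u v w.
  by rewrite /P !(lbracketZr cs _ _ _ (ms m)) ksignZ -scalerDr.
change (P x y z = 0).
apply: (lgr_ind (P := fun u => P u y z = 0) _ _ _ gx) => [u u' Pu Pu'||m a ga].
- by rewrite P1 Pu Pu' addr0.
- exact: (morphD0 (P1 y z)).
rewrite PZ1 (_ : P _ _ _ = 0) ?scaler0 //.
apply: (lgr_ind (P := fun v => P (lcst n a) v z = 0) _ _ _ gy) =>
  [u u' Pu Pu'||m' b gb].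
- by rewrite P2 Pu Pu' addr0.
- exact: (morphD0 (P2 _ z)).
rewrite PZ2 (_ : P _ _ _ = 0) ?scaler0 //.
apply: (lgr_ind (P := fun w => P (lcst n a) (lcst n b) w = 0) _ _ _ gz) =>
  [u u' Pu Pu'||m'' c gc].
- by rewrite P3 Pu Pu' addr0.
- exact: (morphD0 (P3 _ _)).
by rewrite PZ3 /P (bracket_assoc_lcst mus nus ga gb gc) scaler0.
Qed.

End Fixed.
End BracketRelations.

(** * The transferred structure *)

Lemma take_mkseq (T : Type) (f : nat -> T) a k : (a <= k)%N ->
  take a (mkseq f k) = mkseq f a.
Proof. by move=> ak; rewrite /mkseq -map_take take_iota (minn_idPl ak). Qed.

Lemma drop_mkseq (T : Type) (f : nat -> T) a k :
  drop a (mkseq f k) = mkseq (fun t => f (a + t)%N) (k - a).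
Proof.
rewrite /mkseq -map_drop drop_iota add0n -[X in iota X]addn0 iotaDl -map_comp.
by [].
Qed.

Lemma eq_in_mkseq (T : Type) (f g : nat -> T) k :
  (forall t, (t < k)%N -> f t = g t) -> mkseq f k = mkseq g k.
Proof.
move=> fg; apply/eq_in_map => t.
by rewrite mem_iota => /andP[_]; exact: fg.
Qed.

Lemma mkseq_mid (T : Type) (f : nat -> T) j k : (j < k)%N ->
  mkseq f k = mkseq f j ++ f j :: mkseq (fun t => f (j.+1 + t)%N) (k - j.+1).
Proof.
move=> jk; rewrite -{1}(cat_take_drop j (mkseq f k)) take_mkseq 1?ltnW //.
congr (_ ++ _); rewrite (drop_nth (f 0%N)) ?size_mkseq // nth_mkseq //.
by rewrite drop_mkseq.
Qed.

Lemma nth_mktuple_nat (T : zmodType) k (f : nat -> T) t : (t < k)%N ->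
  [tuple f s | s < k]`_t = f t.
Proof. by move=> tk; rewrite -(tnth_nth _ _ (Ordinal tk)) tnth_mktuple. Qed.

Section ConcreteTransfer.
Variables (C : fieldType) (V W : gradedModule C).
Local Notation A := {poly C}.
Variables (theta1 : {linear W -> W}) (p : {linear V -> W}).
Variables (i : {linear W -> V}) (h : {linear V -> V}) (rho2 : lmaps V 2).
Hypothesis cs : conformal_sesquilinear rho2.

Lemma lsubst_lbracket n n' (tau : 'I_n -> {mpoly A[n']}) mu (x y : lpoly V n) :
  (forall s, lscalar (tau s)) ->
  lsubst tau (lbracket rho2 mu x y)
    = lbracket rho2 (msubst tau mu) (lsubst tau x) (lsubst tau y).
Proof.
move=> taus; rewrite /lbracket lsubst_lext //; last exact: (clinear_bracket cs).
apply: eq_lext => a; rewrite lsubst_lext //; last exact: (clinear_brr cs).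
by apply: eq_lext => b; rewrite lsubst_comp.
Qed.

Definition lword_r n :=
  word_r (@lbracket C V rho2 n) (@lmap A W V n i) (@lmap A V V n h).
Definition lword_hr n :=
  word_hr (@lbracket C V rho2 n) (@lmap A W V n i) (@lmap A V V n h).
Definition lword_theta n :=
  word_theta (@lbracket C V rho2 n) (@lmap A W W n theta1) (@lmap A V W n p)
    (@lmap A W V n i) (@lmap A V V n h).

Lemma lword_rE n (w : seq (int * {mpoly A[n]} * lpoly W n)) :
  lword_r w =
  splits (fun u v => lbracket rho2 (wlab u) (lword_hr u) (lword_hr v)) w.
Proof. exact: word_rE (lbracketDl cs (n := n)) (lbracketDr cs (n := n)) w. Qed.

(** The two recursions agree. Letters live over [W] and the arguments of r_k in [V], so [x] lifts
    [v] through [i]; the degrees [d] are arbitrary because the value of [word_r] does not involve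
    them. *)
Lemma lsubst_transfer_r n k (v : k.-tuple V) (tau : nat -> {mpoly A[n]})
    (x : nat -> lpoly W n) (d : nat -> int) :
  (0 < k)%N -> (forall s, lscalar (tau s)) ->
  (forall t, (t < k)%N -> lmap i (x t) = lcst n v`_t) ->
  let w := mkseq (fun t => (d t, tau t, x t)) k in
  lsubst (fun s : 'I_k.-1 => tau s) (h_comp h (transfer_r rho2 h) k v) =
    lword_hr w
  /\ lsubst (fun s : 'I_k.-1 => tau s) (transfer_r rho2 h k v) = lword_r w.
Proof.
have [N] := ubnP k; elim: N k v tau x d => // N IH k v tau x d.
rewrite ltnS => kN k0 taus xv w.
suff rE : lsubst (fun s : 'I_k.-1 => tau s) (transfer_r rho2 h k v) = lword_r w.
  split=> //; rewrite /h_comp; case: eqP => [k1|/eqP k1].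
    have w1 : w = [:: (d 0%N, tau 0%N, x 0%N)] by rewrite /w k1.
    rewrite w1 /lword_hr
      (word_hr1 _ _ (lbracketDl cs (n := n)) (lbracketDr cs (n := n))).
    by rewrite [RHS]xv ?k1 // lsubst_lcst.
  by rewrite lsubst_lmap rE /lword_hr word_hr_r // size_mkseq.
rewrite transfer_rE lword_rE splitsE size_mkseq.
have hr0 : lword_hr [::] = 0 :> lpoly V n by exact: word_hr_nil.
have b0l mu (y : lpoly V n) : lbracket rho2 mu 0 y = 0.
  exact: morphD0 (lbracketDl cs mu y).
have b0r mu (y : lpoly V n) : lbracket rho2 mu y 0 = 0.
  exact: morphD0 (lbracketDr cs mu y).
(* The cuts at 0 and at [k], absent from the definition of r_k, contribute 0. *)
rewrite [RHS]big_ltn // [in RHS]big_nat_recr //= take0 hr0 b0l add0r.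
rewrite drop_oversize ?size_mkseq // hr0 b0r addr0.
have sD := lsubstD (V := V) (fun s : 'I_k.-1 => tau s).
rewrite (big_morph _ sD (morphD0 sD)); apply: eq_big_nat => a /andP[a0 ak].
rewrite (eq_bigl (pred1 (k - a)%N)) => [|b /=]; last by apply/eqP/eqP; lia.
rewrite big_nat1_eq; case: ifP => [_|]; last by lia.
rewrite [rho2_tensor _ _ _ _]/(lbracket _ _ _ _) lsubst_lbracket //.
rewrite msubst_sum take_mkseq ?(ltnW ak) // drop_mkseq.
have aN : (a < N)%N by exact: leq_trans kN.
have kaN : (k - a < N)%N by apply: leq_trans kN; rewrite ltn_subrL a0.
have -> : wlab (mkseq (fun t => (d t, tau t, x t)) a) =
    \sum_(0 <= t < a) msubst (fun s : 'I_k.-1 => tau s) (lvar t).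
  rewrite /wlab big_map /index_iota subn0 !big_seq; apply: eq_bigr => t.
  by rewrite mem_iota add0n => /andP[_ ta]; rewrite msubst_lvar_lt //; lia.
have xa t : (t < a)%N -> lmap i (x t) = lcst n [tuple v`_s | s < a]`_t.
  move=> ta; rewrite (nth_mktuple_nat (fun s => v`_s)) // xv //.
  exact: ltn_trans ak.
have xb t : (t < k - a)%N ->
    lmap i (x (a + t)%N) = lcst n [tuple v`_(a + s) | s < k - a]`_t.
  by move=> ta; rewrite (nth_mktuple_nat (fun s => v`_(a + s))) // xv //; lia.
have [<- _] := IH a _ tau x d aN a0 taus xa.
have ka0 : (0 < k - a)%N by rewrite subn_gt0.
have [<- _] := IH (k - a)%N _ (fun t => tau (a + t)%N) (fun t => x (a + t)%N)
  (fun t => d (a + t)%N) kaN ka0 (fun s => taus (a + s)%N) xb.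
rewrite !lsubst_comp; apply: (congr2 (lbracket rho2 _)); apply: eq_lsubst => s.
  by apply: msubst_lvar_lt; have := ltn_ord s; lia.
by apply: msubst_lvar_lt; have := ltn_ord s; lia.
Qed.

Local Notation theta := (transfer_theta rho2 theta1 p i h).

Lemma lsubst_transfer_theta n k (v : k.-tuple W) (tau : nat -> {mpoly A[n]})
    (d : nat -> int) :
  (0 < k)%N -> (forall s, lscalar (tau s)) ->
  lsubst (fun s : 'I_k.-1 => tau s) (theta v)
    = lword_theta (mkseq (fun t => (d t, tau t, lcst n v`_t)) k).
Proof.
move=> k0 taus; rewrite /transfer_theta; case: eqP => [k1|/eqP k1].
  have mk1 T (f : nat -> T) : mkseq f k = [:: f 0%N] by rewrite k1.
  rewrite mk1 /lword_theta (word_theta1 _ _ _ _ (lbracketDl cs (n := n))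
    (lbracketDr cs (n := n))).
  by rewrite [RHS]lmap_lcst lsubst_lcst.
rewrite lsubst_lmap.
have xv t : (t < k)%N -> lmap i (lcst n v`_t) = lcst n (map_tuple i v)`_t.
  by move=> tk; rewrite lmap_lcst (nth_map 0) ?size_tuple.
rewrite (lsubst_transfer_r d k0 taus xv).2.
by rewrite /lword_theta word_theta_r // size_mkseq.
Qed.

Lemma lword_thetaD n u v d b (x y : lpoly W n) :
  lword_theta (u ++ (d, b, x + y) :: v)
    = lword_theta (u ++ (d, b, x) :: v) + lword_theta (u ++ (d, b, y) :: v).
Proof.
exact: word_thetaD (lbracketDl cs (n := n)) (lbracketDr cs (n := n)) _ _ _ _ _ _.
Qed.

Lemma lword_thetaZ n u v d b f (x : lpoly W n) : lscalar f ->
  lword_theta (u ++ (d, b, f *: x) :: v) =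
    f *: lword_theta (u ++ (d, b, x) :: v).
Proof.
move=> fs; apply: (word_theta_scale _ _ _ _ (K := fun _ => True)
  (lbracketDl cs (n := n)) (lbracketDr cs (n := n)) (c := fun _ _ => f)) => //.
- by move=> *; exact: lbracketZr.
- by move=> *; exact: lbracketZl.
Qed.

(** Using a polynomial as a letter is the same as extending linearly over the lambdas, so a
    composition of maps is a word with a value as one letter. *)
Lemma lext_word_theta n u v d b (x : lpoly W n) :
  lext (fun a => lword_theta (u ++ (d, b, lcst n a) :: v)) x
    = lword_theta (u ++ (d, b, x) :: v).
Proof.
have FD : {morph (fun a => lword_theta (u ++ (d, b, lcst n a) :: v)) :
    a a' / a + a'}.
  by move=> a a'; rewrite lcstD lword_thetaD.
apply: (@eq_lpoly A W n _
  (lext (fun a => lword_theta (u ++ (d, b, lcst n a) :: v)))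
  (fun x => lword_theta (u ++ (d, b, x) :: v))) => {x}.
- exact: lextD FD.
- exact: lword_thetaD.
move=> m x; rewrite lext_lmono; last exact: morphD0 FD.
by rewrite lmonoE lword_thetaZ //; exact: lscalarU.
Qed.

(** Matches a summand of the A_infty-relation with one of [insertionsE]. *)
Lemma insertion_transfer_theta k l n j (v : n.-tuple W) (d : nat -> int) :
  (0 < l)%N -> (k + l = n.+1)%N -> (j < k)%N ->
  let w := mkseq (fun t => (d t, lvar t, lcst n.-1 v`_t)) n in
  insertion (@transfer_theta A V W rho2 theta1 p i h k)
            (@transfer_theta A V W rho2 theta1 p i h l) j v
  = lword_theta (take j w
      ++ contract (@lword_theta n.-1) (take l (drop j w)) :: drop (j + l) w).
Proof.
move=> l0 kl jk w.
have -> : take j w = mkseq (fun t => (d t, lvar t, lcst n.-1 v`_t)) j.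
  by apply: take_mkseq; lia.
have -> : take l (drop j w) =
    mkseq (fun t => (d (j + t)%N, lvar (j + t), lcst n.-1 v`_(j + t))) l.
  by rewrite drop_mkseq take_mkseq //; lia.
rewrite drop_mkseq.
set w1 := mkseq _ j; set w2 := mkseq _ l; set w3 := mkseq _ (n - _).
have lv m s : lscalar (lvar s : {mpoly A[m]}) by exact: lscalar_lvar.
have e2 : lsubst (fun s : 'I_l.-1 => lvar (j + s))
    (theta [tuple v`_(j + t) | t < l]) = lword_theta w2.
  rewrite (lsubst_transfer_theta _ (tau := fun t => lvar (j + t))
    (fun t => d (j + t)%N)) //.
  congr lword_theta; apply: eq_in_mkseq => t tl.
  by rewrite (nth_mktuple_nat (fun t => v`_(j + t))).
have labw2 : wlab w2 = \sum_(j <= t < j + l) lvar t.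
  by rewrite /wlab big_map /index_iota addKn -[in RHS](addn0 j) iotaDl big_map.
rewrite /contract -lext_word_theta -e2 /insertion; apply: eq_lext => x.
(* Degrees for the outer word, chosen to agree with those of the contracted word. *)
pose dd t := if (t < j)%N then d t
  else if t == j then wdeg w2 - 1 else d (t + l.-1)%N.
have ls s : lscalar (ins_labels j l (fun t => lvar t : {mpoly A[n.-1]}) s).
  by rewrite /ins_labels; case: ifP => // _; case: ifP => // _;
    exact: lscalar_sum.
apply: etrans (lsubst_transfer_theta _ dd (leq_ltn_trans (leq0n j) jk) ls) _.
congr lword_theta; rewrite (mkseq_mid _ jk); congr (_ ++ _ :: _).
- apply: eq_in_mkseq => t tj; rewrite /dd /ins_labels tj.
  rewrite (nth_mktuple_nat (fun t => if (t < j)%N then v`_t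
     else if t == j then x else v`_(t + l.-1))) ?tj //; exact: ltn_trans jk.
- rewrite /dd /ins_labels ltnn eqxx labw2.
  rewrite (nth_mktuple_nat (fun t => if (t < j)%N then v`_t
     else if t == j then x else v`_(t + l.-1))) // ltnn eqxx.
  by [].
rewrite /w3 (_ : (n - (j + l) = k - j.+1)%N); last by lia.
apply: eq_in_mkseq => t tj.
have ejt : (j.+1 + t + l.-1 = j + l + t)%N by lia.
have ntj : (j.+1 + t < j)%N = false by lia.
have netj : (j.+1 + t == j)%N = false by lia.
rewrite /dd /ins_labels ntj netj ejt.
rewrite (nth_mktuple_nat (fun t => if (t < j)%N then v`_t
     else if t == j then x else v`_(t + l.-1))); last by lia.
by rewrite ntj netj ejt.
Qed.

End ConcreteTransfer.

(** * The A_infty[1]-structure on W *)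

Section TransferTheorem.
Variables (C : fieldType) (V W : gradedModule C).
Local Notation A := {poly C}.
Variables (rho1 : {linear V -> V}) (theta1 : {linear W -> W}).
Variables (p : {linear V -> W}) (i : {linear W -> V}) (h : {linear V -> V}).
Variable rho2 : lmaps V 2.
Hypothesis ccW : chain_complex theta1.
Hypothesis cd : contraction_data rho1 theta1 p i h.
Hypothesis AV : Ainfty1_conformal (two_maps rho1 rho2).

Let cs : conformal_sesquilinear rho2 := ai_sesquilinear AV (k := 2) isT.
Local Notation theta := (transfer_theta rho2 theta1 p i h).
Local Notation lword_theta n := (@lword_theta C V W theta1 p i h rho2 n).

Lemma eq_lmap (U X : lmodType A) n (f g : U -> X) :
  f =1 g -> @lmap A U X n f =1 lmap g.
Proof. by move=> fg; apply: eq_lext => x; rewrite fg. Qed.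

Lemma lmap_zero (U X : lmodType A) n (f : U -> X) (u : lpoly U n) :
  (forall x, f x = 0) -> lmap f u = 0.
Proof. by move=> f0; apply: big1 => m _; rewrite f0 lcst0 scaler0. Qed.

(** The abstract theorem for the spaces V[Lambda] and W[Lambda], with [lbracket] as product and
    [lscalar] labels. *)
Lemma lword_relation n (w : seq (int * {mpoly A[n]} * lpoly W n)) :
  valid (@lgr C W n) (@lscalar C n) w -> w != [::] ->
  insertions (lword_theta n) (lword_theta n) w = 0.
Proof.
apply: (word_transfer (rho1 := @lmap A V V n rho1) (gE := @lgr C V n)
  (lbracketDl cs (n := n)) (lbracketDr cs (n := n))).
- exact: lscalar0.
- exact: lscalarD.
- exact: lgr0.
- exact: lgrD.
- by move=> b d e x y _; apply: lgr_lbracket; exact: (ai_degree AV (k := 2)).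
- by move=> d x; apply: lgr_lmap; exact: cd_h_degree cd.
- by move=> d x gx; rewrite -[d]addr0; apply: lgr_lmap gx;
  exact: cd_i_degree cd.
- by move=> b d e x y; exact: (bracket_differential AV).
- by move=> b c d e f x y z; exact: (bracket_assoc AV).
- by move=> x; apply: etrans (lmap_comp _ _ _) _; apply: lmap_zero;
  exact: cc_square ccW.
- move=> x; apply: etrans (lmap_comp _ _ _) (etrans _ (esym (lmap_comp _ _ _))).
  by apply: eq_lmap; exact: cd_p_chain cd.
- move=> x; apply: etrans (lmap_comp _ _ _) (etrans _ (esym (lmap_comp _ _ _))).
  by apply: eq_lmap; exact: cd_i_chain cd.
move=> x; apply: (@eq_lpoly A V n _ (fun x => lmap i (lmap p x) - x)
  (fun x => lmap rho1 (lmap h x) + lmap h (lmap rho1 x))) => {x}.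
- by move=> x y; rewrite !raddfD addrACA.
- by move=> x y; rewrite !raddfD addrACA.
move=> m x; rewrite !lmap_lmono -lmonoD -(cd_homotopy cd) lmonoD.
congr (_ + _); apply: (addrI (lmono m x)); rewrite subrr -lmonoD subrr.
by rewrite lmono0.
Qed.

(** The generic word, labelled by the variables themselves. There are only n - 1 of them, so the
    last label is the default value 0 of [lvar]. *)
Definition lword n (d : nat -> int) (v : n.-tuple W) :=
  mkseq (fun t => (d t, lvar t : {mpoly A[n.-1]}, lcst n.-1 v`_t)) n.

Lemma valid_lword n (d : 'I_n -> int) (v : n.-tuple W) :
  (forall t, gr (d t) (tnth v t)) ->
  valid (@lgr C W n.-1) (@lscalar C n.-1)
    (lword (fun t => oapp d 0 (insub t)) v).
Proof.
move=> gv x /mapP[t]; rewrite mem_iota add0n => /andP[_ tn] ->.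
split; last first.
  exact: lscalar_lvar.
rewrite /= insubT /=; apply: lgr_lmono.
by rewrite -(tnth_nth 0 v (Ordinal tn)).
Qed.

Lemma transfer_theta_relation n (d : 'I_n -> int) (v : n.-tuple W) :
  (0 < n)%N ->
  (forall t, gr (d t) (tnth v t)) ->
  \sum_(1 <= k < n.+1) \sum_(1 <= l < n.+1 | (k + l == n.+1)%N)
    \sum_(j < k) (-1) ^+ `|(\sum_(t < n | (t < j)%N) d t)%R|%N
      *: insertion (@transfer_theta A V W rho2 theta1 p i h k)
           (@transfer_theta A V W rho2 theta1 p i h l) j v = 0.
Proof.
move=> n0 gv; pose dd t := oapp d 0 (insub t).
pose w := lword dd v; have vw := valid_lword gv.
have w0 : w != [::] by rewrite -size_eq0 size_mkseq -lt0n.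
rewrite -[RHS](lword_relation vw w0) insertionsE size_mkseq.
rewrite (insertion_reindex n (fun k l j =>
  (-1) ^+ `|(\sum_(t < n | (t < j)%N) d t)%R|%N
      *: insertion (@transfer_theta A V W rho2 theta1 p i h k)
           (@transfer_theta A V W rho2 theta1 p i h l) j v)).
apply: eq_big_nat => j /andP[_ jn].
rewrite (big_morph _ (ksignDr _) (ksign0r _ _));
  apply: eq_big_nat => l /andP[_ ln].
rewrite ksignE (insertion_transfer_theta theta1 p i h cs v dd) //; [|lia..].
congr ksign; rewrite /w /lword take_mkseq 1?ltnW // /wdeg big_map.
rewrite -[j in iota 0 j]subn0 -/(index_iota 0 j) (@big_nat_widen _ _ _ 0 j n)
  1?ltnW // big_mkord.
by apply: eq_bigr => t _; rewrite /dd valK.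
Qed.

Lemma transfer_theta_degree k : (0 < k)%N ->
  lmaps_homogeneous (- 1) (@transfer_theta A V W rho2 theta1 p i h k).
Proof.
move=> k0 d v gv; pose dd t := oapp d 0 (insub t).
(* Substituting each variable for itself exhibits [theta v] as a value on a word. *)
rewrite -[theta v]lsubst_id.
pose w := lword dd v.
rewrite (lsubst_transfer_theta theta1 p i h cs v (tau := fun t => lvar t) dd) //
  -/(lword _ _) -/w; last first.
  exact: lscalar_lvar.
have -> : \sum_(t < k) d t = wdeg w.
  rewrite /w /lword /wdeg big_map -[k in iota 0 k]subn0 -/(index_iota 0 k)
    big_mkord.
  by apply: eq_bigr => t _; rewrite /dd valK.
rewrite -/(lgr _ _).
apply: (word_theta_degree (gE := @lgr C V _) (gE' := @lgr C W _)
  (K := @lscalar C _)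
  (lbracketDl cs (n := k.-1)) (lbracketDr cs (n := k.-1))).
- exact: lscalar0.
- exact: lscalarD.
- exact: lgr0.
- exact: lgrD.
- by move=> b e e' x y _; apply: lgr_lbracket; exact: (ai_degree AV (k := 2)).
- by move=> e x; apply: lgr_lmap; exact: cd_h_degree cd.
- by move=> e x gx; rewrite -[e]addr0; apply: lgr_lmap gx;
  exact: cd_i_degree cd.
- exact: lgr0.
- exact: lgrD.
- by move=> e x gx; rewrite -[e]addr0; apply: lgr_lmap gx;
  exact: cd_p_degree cd.
- by move=> e x; apply: lgr_lmap; exact: cc_degree ccW.
exact: valid_lword.
Qed.

Lemma scaler_deriv_label (R : comNzRingType) (E : lmodType R) (a b : R) (x : E) :
  - (a + (b + 0)) *: x + a *: x = - b *: x.
Proof. by rewrite -scalerDl addr0 opprD addrAC addNr add0r. Qed.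

(** On the last letter, d collects the label of every factor attached on its left. Once a factor is
    attached on its right, d acts on the left argument as minus the label of that argument; this
    cancels [wlab u] and leaves [- b]. *)
Lemma lword_theta_deriv n u v d b (x : lpoly W n) :
  klabels (@lscalar C n) u -> klabels (@lscalar C n) v -> lscalar b ->
  lword_theta n (u ++ (d, b, ('X%:MP : {mpoly A[n]}) *: x) :: v)
  = (if v == [::] then 'X%:MP + wlab u else - b)
      *: lword_theta n (u ++ (d, b, x) :: v).
Proof.
have labs (w : seq (int * {mpoly A[n]} * lpoly W n)) :
    klabels (@lscalar C n) w -> lscalar (wlab w).
  elim: w => [|y w IH] kw; first by rewrite /wlab big_nil; exact: lscalar0.
  rewrite wlab_cons; apply: lscalarD; first by apply: kw; exact: mem_head.
  by apply: IH; exact: (klabels_cat (u := [:: y]) kw).2.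
move=> ku kv bs; apply: (word_theta_scale _ _ _ _ (K := @lscalar C n)
  (lbracketDl cs (n := n)) (lbracketDr cs (n := n))
  (c := fun u v => if v == [::] then 'X%:MP + wlab u else - b)) => //.
- by rewrite /wlab big_nil addr0.
- move=> a a' w X Y kaa; case: eqP => _; last first.
    by apply: (lbracketZr cs); exact: lscalarN.
  rewrite scalerDl (lbracketDr cs) (lbracket_dr cs).
  rewrite (lbracketZr cs); last by apply: labs; exact: (klabels_cat kaa).2.
  by rewrite -scalerDl wlab_cat addrA.
move=> w a a' X Y kw ka a'0.
rewrite (_ : (a ++ a' == [::]) = false); last first.
  by case: a' a'0 {ka} => //; case: a.
have [->|a0] := eqVneq a [::]; last by apply: (lbracketZl cs); exact: lscalarN.
rewrite scalerDl (lbracketDl cs) (lbracket_dl cs) (lbracketZl cs);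
  last exact: labs.
by rewrite wlab_cat wlab_cons {2}/wlab big_nil; exact: scaler_deriv_label.
Qed.

(** Isolates the letter at [j] for the linearity lemmas; degree 0 is an arbitrary choice, as the
    value is independent of the degrees. *)
Lemma transfer_theta_tupd k (v : k.-tuple W) (j : 'I_k) x :
  let f t := (0 : int, lvar t : {mpoly A[k.-1]}, lcst k.-1 v`_t) in
  theta (tupd v j x) = lword_theta k.-1 (mkseq f j ++ (0, lvar j, lcst k.-1 x)
     :: mkseq (fun t => f (j.+1 + t)%N) (k - j.+1)).
Proof.
move=> f; have k0 : (0 < k)%N := leq_ltn_trans (leq0n j) (ltn_ord j).
rewrite -[LHS]lsubst_id.
rewrite (lsubst_transfer_theta theta1 p i h cs _ (tau := fun t => lvar t)
  (fun=> 0)) //; last exact: lscalar_lvar.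
have nu t : (t < k)%N -> (tupd v j x)`_t = if t == j then x else v`_t.
  by move=> tk; rewrite -(tnth_nth _ _ (Ordinal tk)) tnth_mktuple (tnth_nth 0).
congr (lword_theta _ _); rewrite (mkseq_mid _ (ltn_ord j)); congr (_ ++ _ :: _).
- apply: eq_in_mkseq => t tj; rewrite nu ?(ltn_trans tj) //.
  by rewrite (ltn_eqF tj).
- by rewrite nu // eqxx.
apply: eq_in_mkseq => t tj; rewrite nu; last by lia.
by rewrite (_ : (j.+1 + t == j)%N = false) //; lia.
Qed.

Lemma tupd_tnth (T : Type) k (v : k.-tuple T) (j : 'I_k) :
  tupd v j (tnth v j) = v.
Proof. by apply: eq_from_tnth => t; rewrite tnth_mktuple; case: eqP => [->|]. Qed.

Lemma transfer_theta_sesquilinear k : (0 < k)%N ->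
  conformal_sesquilinear (@transfer_theta A V W rho2 theta1 p i h k).
Proof.
move=> k0.
have kl l f (m : nat -> lpoly W k.-1) : klabels (@lscalar C k.-1)
    (mkseq (fun t => (0 : int, lvar (f t) : {mpoly A[k.-1]}, m t)) l).
  by move=> x /mapP[t _ ->]; exact: lscalar_lvar.
split.
- move=> v j c x y; rewrite !transfer_theta_tupd lcstD lcstZ.
  rewrite (lword_thetaD _ _ _ _ cs).
  by rewrite (lword_thetaZ _ _ _ _ cs) //; exact: lscalarC.
- move=> v j jk; rewrite -{3}(tupd_tnth v j) !transfer_theta_tupd lcstZ.
  rewrite lword_theta_deriv; [|exact: kl|exact: kl|exact: lscalar_lvar].
  by rewrite -size_eq0 size_mkseq ifF //; lia.
move=> v j jk; rewrite -{3}(tupd_tnth v j) !transfer_theta_tupd lcstZ.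
rewrite lword_theta_deriv; [|exact: kl|exact: kl|exact: lscalar_lvar].
rewrite -size_eq0 size_mkseq ifT; last by lia.
by rewrite {1}/wlab big_map -[X in iota 0 X]subn0 -/(index_iota 0 j) jk.
Qed.

End TransferTheorem.

Theorem theorem3p14 (R : realType) (V W : gradedModule R[i])
    (rho1 : {linear V -> V}) (theta1 : {linear W -> W})
    (p : {linear V -> W}) (i : {linear W -> V}) (h : {linear V -> V})
    (rho2 : lmaps V 2) :
  chain_complex rho1 -> chain_complex theta1 ->
  contraction_data rho1 theta1 p i h ->
  Ainfty1_conformal (two_maps rho1 rho2) ->
  Ainfty1_conformal (transfer_theta rho2 theta1 p i h).
Proof.
move=> _ ccW cd AV; split.
- exact: transfer_theta_sesquilinear AV.
- exact: transfer_theta_degree ccW cd AV.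
by move=> n n0 d v; exact: (transfer_theta_relation ccW cd AV).
Qed.
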